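(* There exist positive constants $K_1,K_2$ and $K_3$ depending only on $\lambda$ such that $$\mathbb P_\theta\left(\|\widehat\Sigma^{(1)}-\Sigma^{(1)}\|_2\ge K_1\sqrt{\frac{N\log(T)\log(N\log(T))}{T}}\right)\le K_2\left(\sqrt{\frac NT}+\frac{1}{N\log(T)}\right)$$ for all $\theta\in\{0,1\}^{N\times N}$, as long as the pair $(N,T)$ satisfies $N\ge2$ and $T\ge\big(K_3N\log(T)\log(N\log(T))\big)\vee2$. Here $\|\cdot\|_2$ is the matrix operator norm induced by the Euclidean norm.
   Context: Model. Fix $0<\lambda<1$, $0<\mu\le\lambda$ and a partition of $[N]=\{1,\dots,N\}$ into two sets $\mathcal P_+,\mathcal P_-$. For a fixed matrix $\theta\in\{0,1\}^{N\times N}$, $\mathbb P_\theta$ (with covariance $\mathrm{Cov}_\theta$) is the probability measure under which $X=(X_t)_{t\in\mathbb Z}$, $X_t=(X_{1,t},\dots,X_{N,t})\in\{0,1\}^N$, is the (unique in law) stationary Markov chain such that, given $X_{t-1}=x$, the coordinates of $X_t$ are independent with $X_{i,t}\sim\mathrm{Ber}(p_{\theta,i}(x))$, where $$p_{\theta,i}(x)=\mu+(1-\lambda)\Big(\frac1N\sum_{j\in\mathcal P_+}\theta_{ij}x_j+\frac1N\sum_{j\in\mathcal P_-}\theta_{ij}(1-x_j)\Big).$$ Notation. $\Sigma^{(1)}_{ij}=\mathrm{Cov}_\theta(X_{i,1},X_{j,0})$, $i,j\in[N]$. From the sample $X_1,\dots,X_{T+1}$ ($T\ge1$ an integer): $\widehat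 m=\frac1T\sum_{t=1}^TX_t$ and $\widehat\Sigma^{(1)}=\frac1T\sum_{t=1}^T(X_{t+1}-\widehat m)(X_t-\widehat m)^\top$. *)

(* Defs.v *)
From HB Require Import structures.
From mathcomp Require Import all_boot all_order all_algebra.
From mathcomp Require Import all_classical all_reals all_analysis.

Set Implicit Arguments.
Unset Strict Implicit.
Unset Printing Implicit Defensive.
Import Order.TTheory GRing.Theory Num.Theory.
Import numFieldNormedType.Exports.
Local Open Scope classical_set_scope.
Local Open Scope ring_scope.

(* MathComp-Analysis equips matrices with the sup norm, so the Euclidean norm
   and the operator norm it induces are defined here. *)
Definition norm2 (R : realType) (n : nat) (x : 'cV[R]_n) : R :=
  Num.sqrt (\sum_i x i 0 ^+ 2).

Definition opnorm2 (R : realType) (m n : nat) (A : 'M[R]_(m, n)) : R :=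
  sup [set norm2 (A *m x) | x in [set x : 'cV[R]_n | norm2 x <= 1]].

Definition ptheta (R : realType) (N : nat) (lambda mu : R) (Pp Pm : {set 'I_N})
    (theta : 'M[bool]_N) (x : 'I_N -> bool) (i : 'I_N) : R :=
  mu + (1 - lambda) *
    (N%:R^-1 * (\sum_(j in Pp) (theta i j)%:R * (x j)%:R) +
     N%:R^-1 * (\sum_(j in Pm) (theta i j)%:R * (1 - (x j)%:R))).

(* One-step transition probability from x to y: conditionally on x the
   coordinates of y are independent Bernoulli variables. *)
Definition transition (R : realType) (N : nat) (lambda mu : R)
    (Pp Pm : {set 'I_N}) (theta : 'M[bool]_N) (x y : 'I_N -> bool) : R :=
  \prod_i bernoulli_pmf (ptheta lambda mu Pp Pm theta x i) (y i).

Section process.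
Context (d : measure_display) (Omega : measurableType d) (R : realType).
Context (P : probability Omega R) (N : nat).
Variable X : 'I_N -> int -> {RV P >-> bool}.

Definition at_state (t : int) (y : 'I_N -> bool) : set Omega :=
  [set w | forall i, X i t w = y i].

(* The event X_t = s 0, X_(t-1) = s 1, ..., X_(t-k) = s k. *)
Definition history (t : int) (k : nat) (s : nat -> 'I_N -> bool) : set Omega :=
  [set w | forall l : nat, (l <= k)%N -> at_state (t - l%:Z) (s l) w].

(* The law of X is P_theta.  The Markov property is stated in multiplicative
   form, so that histories of probability zero need no separate treatment.
   Such a stationary chain is unique in law, hence a statement about P_theta is
   a statement about every X satisfying this predicate. *)
Definition stationary_chain (lambda mu : R) (Pp Pm : {set 'I_N})
    (theta : 'M[bool]_N) : Prop :=
  (forall (t : int) (k : nat) (s : nat -> 'I_N -> bool) (y : 'I_N -> bool),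
     P (history (t - 1) k s `&` at_state t y) =
     (P (history (t - 1) k s) *
      (transition lambda mu Pp Pm theta (s 0%N) y)%:E)%E) /\
  (forall (t h : int) (k : nat) (s : nat -> 'I_N -> bool),
     P (history (t + h) k s) = P (history t k s)).

Definition Sigma1 : 'M[R]_N :=
  \matrix_(i, j) fine (covariance P (fun w => (X i 1 w)%:R)
                                    (fun w => (X j 0 w)%:R)).

Definition obs (t : nat) (w : Omega) : 'cV[R]_N := \col_i (X i t%:Z w)%:R.

Definition mhat (T : nat) (w : Omega) : 'cV[R]_N :=
  T%:R^-1 *: \sum_(1 <= t < T.+1) obs t w.

Definition Sigma1hat (T : nat) (w : Omega) : 'M[R]_N :=
  T%:R^-1 *: \sum_(1 <= t < T.+1)
    (obs t.+1 w - mhat T w) *m (obs t w - mhat T w)^T.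

End process.

(* Main.v *)
Require Import Defs.
From HB Require Import structures.
From mathcomp Require Import all_boot all_order all_algebra.
From mathcomp Require Import all_classical all_reals all_analysis.
From mathcomp Require Import ring lra zify.

(** The chain is a vector autoregression: writing [X_{t+1} = c + A X_t + eps_{t+1}],
    where [eps] is a martingale difference whose coordinates are conditionally
    independent, both [|A|_2] and the absolute row sums of [A] are at most
    [1 - lambda].  With [Z = X - m], [S0] the empirical mean of [Z_t Z_t^T], [M] that
    of [eps_{t+1} Z_t^T], [delta] that of [Z_t], [delta'] that of [Z_{t+1}] and
    [Delta = S0 - Sigma0],
      [Sigma1hat - Sigma1 = A Delta + M - delta' delta^T],
    and [Delta - A Delta A^T] equals, off the diagonal, a small matrix made of [M], of
    the off-diagonal part [G] of the mean of [eps eps^T], and of boundary terms; on the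
    diagonal [Delta] is linear in [delta] since [X_i^2 = X_i].  A contraction argument in
    the entrywise maximum norm controls the diagonal of [A Delta A^T], and then a
    contraction in operator norm controls [Delta].

    The three noise terms [M], [G] and the mean of [eps] are bounded by testing them
    against a grid of at most [T ^ (5 N)] points of the unit ball.  For each pair of
    grid points an exponential supermartingale, self-normalised by [s^2 (v . Z_t)^2] in
    the case of [M], gives failure probability [exp (- s^2 T)], with
    [s^2 = 14 N ln T / T].  The self-normalisation bounds [|M|] by a multiple of
    [s (|S0| + 1)], and [|S0|] is in turn bounded by the recursion itself. *)

Set Implicit Arguments.
Unset Strict Implicit.
Unset Printing Implicit Defensive.
Import Order.TTheory GRing.Theory Num.Theory.
Import numFieldNormedType.Exports.
Local Open Scope classical_set_scope.
Local Open Scope ring_scope.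

(** * Euclidean and operator norms *)

Section EuclideanNorm.
Variables (R : realType) (n : nat).
Implicit Types (u v w : 'cV[R]_n) (a c : R).

Definition dotv u v : R := (u^T *m v) 0 0.

Lemma dotvE u v : dotv u v = \sum_i u i 0 * v i 0.
Proof. by rewrite /dotv mxE; apply: eq_bigr => i _; rewrite mxE. Qed.

Lemma dotvC u v : dotv u v = dotv v u.
Proof. by rewrite !dotvE; apply: eq_bigr => i _; rewrite mulrC. Qed.

Lemma dotvDl u v w : dotv (u + v) w = dotv u w + dotv v w.
Proof. by rewrite /dotv linearD mulmxDl mxE. Qed.

Lemma dotvDr u v w : dotv w (u + v) = dotv w u + dotv w v.
Proof. by rewrite /dotv mulmxDr mxE. Qed.

Lemma dotvZl a u v : dotv (a *: u) v = a * dotv u v.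
Proof. by rewrite /dotv linearZ -scalemxAl mxE. Qed.

Lemma dotvZr a u v : dotv u (a *: v) = a * dotv u v.
Proof. by rewrite /dotv -scalemxAr mxE. Qed.

Lemma dotvNl u v : dotv (- u) v = - dotv u v.
Proof. by rewrite -scaleN1r dotvZl mulN1r. Qed.

Lemma dotvNr u v : dotv u (- v) = - dotv u v.
Proof. by rewrite -scaleN1r dotvZr mulN1r. Qed.

Lemma dotvBr u v w : dotv w (u - v) = dotv w u - dotv w v.
Proof. by rewrite dotvDr dotvNr. Qed.

Lemma dotv0l u : dotv 0 u = 0.
Proof. by rewrite /dotv trmx0 mul0mx mxE. Qed.

Lemma dotv0r u : dotv u 0 = 0.
Proof. by rewrite dotvC dotv0l. Qed.

Lemma dotv_sumr I (r : seq I) (P : pred I) u (F : I -> 'cV[R]_n) :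
  dotv u (\sum_(i <- r | P i) F i) = \sum_(i <- r | P i) dotv u (F i).
Proof.
by elim/big_rec2: _ => [|i y z _ <-]; [rewrite dotv0r | rewrite dotvDr].
Qed.

Lemma dotv_norm2 u : dotv u u = norm2 u ^+ 2.
Proof.
rewrite /norm2 sqr_sqrtr; first by rewrite dotvE; apply: eq_bigr => i _; rewrite expr2.
by apply: sumr_ge0 => i _; apply: sqr_ge0.
Qed.

Lemma norm2_ge0 u : 0 <= norm2 u. Proof. exact: sqrtr_ge0. Qed.

Lemma norm2_0 : norm2 (0 : 'cV[R]_n) = 0.
Proof.
by apply/eqP; rewrite -sqrf_eq0 -dotv_norm2 dotv0l.
Qed.

Lemma norm2_eq0 u : norm2 u = 0 -> u = 0.
Proof.
move=> u0; have : dotv u u == 0 by rewrite dotv_norm2 u0 expr0n.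
rewrite dotvE psumr_eq0 => [|i _]; last by rewrite -expr2 sqr_ge0.
move=> /allP h; apply/matrixP => i j; rewrite ord1 mxE.
by have := h i (mem_index_enum i); rewrite /= -expr2 sqrf_eq0 => /eqP.
Qed.

Lemma norm2Z a u : norm2 (a *: u) = `|a| * norm2 u.
Proof.
apply/eqP; rewrite -(eqrXn2 (n := 2))// ?mulr_ge0 ?norm2_ge0//.
by rewrite exprMn -!dotv_norm2 dotvZl dotvZr mulrA -expr2 real_normK ?num_real.
Qed.

Lemma norm2N u : norm2 (- u) = norm2 u.
Proof. by rewrite -scaleN1r norm2Z normrN1 mul1r. Qed.

Lemma dotv_le u v : dotv u v <= norm2 u * norm2 v.
Proof.
have [u0|u0] := eqVneq (norm2 u) 0; first by rewrite (norm2_eq0 u0) dotv0l norm2_0 mul0r.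
have [v0|v0] := eqVneq (norm2 v) 0; first by rewrite (norm2_eq0 v0) dotv0r norm2_0 mulr0.
have up : 0 < norm2 u by rewrite lt_neqAle eq_sym u0 norm2_ge0.
have vp : 0 < norm2 v by rewrite lt_neqAle eq_sym v0 norm2_ge0.
(* Cauchy-Schwarz: this square equals [2 |u| |v| (|u| |v| - u . v)], and both norms are positive
   here. *)
have : 0 <= dotv (norm2 v *: u - norm2 u *: v) (norm2 v *: u - norm2 u *: v).
  by rewrite dotv_norm2 sqr_ge0.
rewrite dotvDl !dotvDr !dotvNl !dotvNr !dotvZl !dotvZr !dotv_norm2 (dotvC v u).
have -> : norm2 v * (norm2 v * norm2 u ^+ 2) + - (norm2 v * (norm2 u * dotv u v)) +
   (- (norm2 u * (norm2 v * dotv u v)) + - - (norm2 u * (norm2 u * norm2 v ^+ 2))) =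
   (norm2 u * norm2 v * 2) * (norm2 u * norm2 v - dotv u v) by ring.
by rewrite pmulr_rge0 ?subr_ge0// !mulr_gt0.
Qed.

Lemma normr_dotv_le u v : `|dotv u v| <= norm2 u * norm2 v.
Proof.
rewrite ler_norml dotv_le andbT lerNl -dotvNl -(norm2N u); exact: dotv_le.
Qed.

Lemma norm2D u v : norm2 (u + v) <= norm2 u + norm2 v.
Proof.
rewrite -(ler_pXn2r (n := 2))// ?nnegrE ?addr_ge0 ?norm2_ge0//.
rewrite -dotv_norm2 dotvDl !dotvDr !dotv_norm2 (dotvC v u).
have := dotv_le u v; lra.
Qed.

(** Duality: testing with [v = u / |u|] returns [|u|] itself; [0 <= c] settles the case [u = 0]. *)
Lemma norm2_le_dotv u c : 0 <= c ->
  (forall v, norm2 v <= 1 -> dotv v u <= c) -> norm2 u <= c.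
Proof.
move=> c0 H; have [->|u0] := eqVneq (norm2 u) 0 => //.
have up : 0 < norm2 u by rewrite lt_neqAle eq_sym u0 norm2_ge0.
have := H ((norm2 u)^-1 *: u); rewrite norm2Z ger0_norm ?invr_ge0 ?norm2_ge0//.
by rewrite mulVf// dotvZl dotv_norm2 expr2 mulrA mulVf// mul1r; apply.
Qed.

Lemma norm2_sum_le u : norm2 u <= \sum_i `|u i 0|.
Proof.
rewrite -(ler_pXn2r (n := 2))// ?nnegrE ?norm2_ge0 ?sumr_ge0// -dotv_norm2 dotvE.
rewrite expr2 mulr_suml ler_sum// => i _; rewrite (le_trans (ler_norm _))// normrM.
by rewrite ler_wpM2l// (bigD1 i)//= lerDl sumr_ge0.
Qed.

Lemma norm2_entry u i : `|u i 0| <= norm2 u.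
Proof.
rewrite -(ler_pXn2r (n := 2))// ?nnegrE ?norm2_ge0// -dotv_norm2 dotvE.
by rewrite real_normK ?num_real// (bigD1 i)//= expr2 lerDl sumr_ge0// => j _; rewrite -expr2 sqr_ge0.
Qed.

Lemma norm2_le_bound u c : 0 <= c -> (forall i, `|u i 0| <= c) -> norm2 u <= c * Num.sqrt n%:R.
Proof.
move=> c0 H; rewrite -(ler_pXn2r (n := 2))// ?nnegrE ?norm2_ge0 ?mulr_ge0 ?sqrtr_ge0//.
rewrite -dotv_norm2 dotvE exprMn sqr_sqrtr ?ler0n//.
have -> : c ^+ 2 * n%:R = \sum_(i < n) c ^+ 2 by rewrite sumr_const card_ord mulr_natr.
by apply: ler_sum => i _; rewrite -expr2 -(real_normK (num_real _)) ler_pXn2r ?nnegrE.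
Qed.

End EuclideanNorm.

Lemma dotv_mulmx (R : realType) (m n : nat) (B : 'M[R]_(m, n)) u v :
  dotv u (B *m v) = dotv (B^T *m u) v.
Proof. by rewrite /dotv trmx_mul trmxK mulmxA. Qed.

Section OperatorNorm.
Variables (R : realType) (n : nat).
Implicit Types (u v : 'cV[R]_n) (A B : 'M[R]_n) (c : R).

Let S B : set R := [set norm2 (B *m x) | x in [set x : 'cV[R]_n | norm2 x <= 1]].

Let S0 B : S B !=set0.
Proof. by exists (norm2 (B *m 0)); exists 0 => //=; rewrite norm2_0. Qed.

Lemma norm2_mulmx_bounded B : exists c, forall x, norm2 (B *m x) <= c * norm2 x.
Proof.
exists (\sum_i \sum_j `|B i j|) => x.
rewrite (le_trans (norm2_sum_le _))// mulr_suml ler_sum// => i _.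
rewrite mxE (le_trans (ler_norm_sum _ _ _))// mulr_suml ler_sum// => j _.
by rewrite normrM ler_wpM2l// norm2_entry.
Qed.

Let Sub B : has_ubound (S B).
Proof.
have [c Hc] := norm2_mulmx_bounded B; exists `|c| => _ [x /= x1 <-].
rewrite (le_trans (Hc _))// (le_trans (ler_norm _))// normrM ler_piMr//.
by rewrite ger0_norm ?norm2_ge0.
Qed.

Lemma opnorm2_ge0 B : 0 <= opnorm2 B.
Proof.
apply: (le_trans (norm2_ge0 (B *m 0))); apply: ub_le_sup; first exact: Sub.
by exists 0 => //=; rewrite norm2_0.
Qed.

Lemma opnorm2_ub B x : norm2 (B *m x) <= opnorm2 B * norm2 x.
Proof.
have [x0|x0] := eqVneq (norm2 x) 0.
  by rewrite (norm2_eq0 x0) mulmx0 norm2_0 mulr0.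
have xp : 0 < norm2 x by rewrite lt_neqAle eq_sym x0 norm2_ge0.
rewrite -ler_pdivrMr//.
have -> : norm2 (B *m x) / norm2 x = norm2 (B *m ((norm2 x)^-1 *: x)).
  by rewrite -scalemxAr norm2Z ger0_norm ?invr_ge0 ?norm2_ge0// mulrC.
apply: ub_le_sup; first exact: Sub.
by exists ((norm2 x)^-1 *: x) => //=; rewrite norm2Z ger0_norm ?invr_ge0 ?norm2_ge0// mulVf.
Qed.

Lemma opnorm2_le B c : 0 <= c -> (forall x, norm2 (B *m x) <= c * norm2 x) -> opnorm2 B <= c.
Proof.
move=> c0 H; apply: ge_sup; first exact: S0.
by move=> _ [x /= x1 <-]; rewrite (le_trans (H _))// ler_piMr.
Qed.

Lemma opnorm2_dotv B u v : `|dotv u (B *m v)| <= opnorm2 B * (norm2 u * norm2 v).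
Proof.
rewrite (le_trans (normr_dotv_le _ _))// mulrCA ler_wpM2l ?norm2_ge0//.
exact: opnorm2_ub.
Qed.

Lemma opnorm2_le_dotv B c : 0 <= c ->
  (forall u v, norm2 u <= 1 -> norm2 v <= 1 -> dotv u (B *m v) <= c) -> opnorm2 B <= c.
Proof.
move=> c0 H; apply: ge_sup; first exact: S0.
by move=> _ [x /= x1 <-]; apply: norm2_le_dotv => // v v1; apply: H.
Qed.

Lemma opnorm2D A B : opnorm2 (A + B) <= opnorm2 A + opnorm2 B.
Proof.
apply: opnorm2_le => [|x]; first by rewrite addr_ge0 ?opnorm2_ge0.
by rewrite mulmxDl mulrDl (le_trans (norm2D _ _))// lerD// opnorm2_ub.
Qed.

Lemma opnorm2N B : opnorm2 (- B) = opnorm2 B.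
Proof.
by congr sup; apply: eq_imagel => x _; rewrite mulNmx norm2N.
Qed.

Lemma opnorm2B A B : opnorm2 (A - B) <= opnorm2 A + opnorm2 B.
Proof. by rewrite (le_trans (opnorm2D _ _))// opnorm2N. Qed.

Lemma opnorm2M A B : opnorm2 (A *m B) <= opnorm2 A * opnorm2 B.
Proof.
apply: opnorm2_le => [|x]; first by rewrite mulr_ge0 ?opnorm2_ge0.
by rewrite -mulmxA -mulrA (le_trans (opnorm2_ub _ _))// ler_wpM2l ?opnorm2_ge0 ?opnorm2_ub.
Qed.

Lemma opnorm2_tr_le B : opnorm2 B^T <= opnorm2 B.
Proof.
apply: opnorm2_le_dotv => [|u v u1 v1]; first exact: opnorm2_ge0.
rewrite dotv_mulmx trmxK dotvC (le_trans (ler_norm _))//.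
rewrite (le_trans (opnorm2_dotv _ _ _))// ler_piMr ?opnorm2_ge0//.
by rewrite mulr_ile1 ?norm2_ge0.
Qed.

Lemma opnorm2_entry B i j : `|B i j| <= opnorm2 B.
Proof.
have e k : norm2 (delta_mx k 0 : 'cV[R]_n) = 1.
  apply/eqP; rewrite -(eqrXn2 (n := 2))// ?norm2_ge0// -dotv_norm2 dotvE expr1n.
  rewrite (bigD1 k)//= big1 ?addr0 ?mxE ?eqxx ?mulr1// => l /negbTE lk.
  by rewrite !mxE lk mul0r.
have := opnorm2_ub B (delta_mx j 0); rewrite e mulr1; apply: le_trans.
apply: le_trans (norm2_entry _ i); rewrite mxE (bigD1 j)//= big1 => [|l /negbTE lj].
  by rewrite mxE !eqxx mulr1 addr0.
by rewrite mxE lj mulr0.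
Qed.

Lemma opnorm2_diag B c : 0 <= c -> (forall i j, i != j -> B i j = 0) ->
  (forall i, `|B i i| <= c) -> opnorm2 B <= c.
Proof.
move=> c0 B0 Bc; apply: opnorm2_le => // x.
rewrite -(ler_pXn2r (n := 2))// ?nnegrE ?mulr_ge0 ?norm2_ge0//.
rewrite exprMn -!dotv_norm2 !dotvE mulr_sumr ler_sum// => i _.
have -> : (B *m x) i 0 = B i i * x i 0.
  by rewrite mxE (bigD1 i)//= big1 ?addr0// => j ij; rewrite B0 1?eq_sym// mul0r.
rewrite mulrACA ler_wpM2r -?expr2 ?sqr_ge0// -(real_normK (num_real _)).
by rewrite ler_pXn2r ?nnegrE.
Qed.

Lemma opnorm2_outer u v : opnorm2 (u *m v^T) <= norm2 u * norm2 v.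
Proof.
apply: opnorm2_le => [|x]; first by rewrite mulr_ge0 ?norm2_ge0.
rewrite -mulmxA [v^T *m x]mx11_scalar mul_mx_scalar norm2Z mulrC -mulrA.
by rewrite ler_wpM2l ?norm2_ge0// normr_dotv_le.
Qed.

End OperatorNorm.

Lemma norm2_mono (R : realType) (n : nat) (u v : 'cV[R]_n) :
  (forall i, `|u i 0| <= `|v i 0|) -> norm2 u <= norm2 v.
Proof.
move=> H; rewrite -(ler_pXn2r (n := 2))// ?nnegrE ?norm2_ge0// -!dotv_norm2 !dotvE.
apply: ler_sum => i _; rewrite -!expr2 -(real_normK (num_real (u i 0))).
by rewrite -(real_normK (num_real (v i 0))) ler_pXn2r ?nnegrE.
Qed.

(** * Discretisation of the unit ball *)

Section Net.
Variables (R : realType) (n : nat).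

(** Codes for a grid of mesh [1 / (4 n)] in the cube, each coordinate being a sign and a magnitude.
    Zero is coded twice, which only enlarges the count in the union bound. *)
Definition net := {ffun 'I_n -> bool * 'I_(4 * n).+1}.

Definition netpt (k : net) : 'cV[R]_n :=
  \col_i ((-1) ^+ (k i).1 * ((k i).2%:R / (4 * n)%:R)).

Lemma card_net : #|{: net}| = ((2 * (4 * n).+1) ^ n)%N.
Proof. by rewrite card_ffun card_prod card_bool !card_ord. Qed.

(* Rounding towards zero keeps the approximating point in the unit ball. *)
Lemma net_approx (u : 'cV[R]_n) : (0 < n)%N -> norm2 u <= 1 ->
  exists k : net, norm2 (netpt k) <= 1 /\ norm2 (u - netpt k) <= 4^-1.
Proof.
move=> n0 u1; set M : R := (4 * n)%:R.
have M0 : 0 < M by rewrite ltr0n muln_gt0.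
have u1i i : `|u i 0| <= 1 by rewrite (le_trans (norm2_entry _ _)).
have htr i : (Num.truncn (M * `|u i 0|)%R < (4 * n).+1)%N.
  rewrite truncn_lt_nat ?mulr_ge0 ?(ltW M0)//; apply: (@le_lt_trans _ _ M).
    by rewrite ler_piMr ?(ltW M0).
  by rewrite ltr_nat.
pose k : net := [ffun i => (u i 0 < 0, Ordinal (htr i))].
have pk i : netpt k i 0 = (-1) ^+ (u i 0 < 0)%R * ((Num.truncn (M * `|u i 0|))%:R / M).
  by rewrite mxE ffunE.
have uk i : u i 0 = (-1) ^+ (u i 0 < 0)%R * `|u i 0| by rewrite -numEsign.
have lb i : (Num.truncn (M * `|u i 0|))%:R / M <= `|u i 0|.
  by rewrite ler_pdivrMr// mulrC truncn_le ?mulr_ge0 ?(ltW M0).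
exists k; split.
  apply: le_trans u1; apply: norm2_mono => i.
  rewrite pk normrM normrX normrN1 expr1n mul1r ger0_norm//.
  by rewrite divr_ge0// ltW.
(* A coordinatewise error of at most [1 / (4 n)] gives Euclidean error at most
   [sqrt n / (4 n) <= 1/4]. *)
have b i : `|(u - netpt k) i 0| <= M^-1.
  rewrite mxE [(- netpt k) i 0]mxE pk {1}uk -mulrBr normrM normrX normrN1 expr1n mul1r.
  rewrite ger0_norm ?subr_ge0// -(ler_pM2l M0) mulrBr divff ?gt_eqF//.
  rewrite mulrCA divff ?gt_eqF// mulr1.
  have := truncnS_gt (M * `|u i 0|); rewrite -natr1; lra.
apply: le_trans (norm2_le_bound _ b) _; first by rewrite invr_ge0 ltW.
rewrite mulrC ler_pdivrMr// /M natrM mulrA mulVf ?pnatr_eq0// mul1r.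
rewrite -(ler_pXn2r (n := 2))// ?nnegrE ?sqrtr_ge0// sqr_sqrtr ?ler0n//.
by rewrite -natrX ler_nat expnS expn1 leq_pmulr.
Qed.

(** Replacing a test vector by its grid approximation costs a quarter of [|e|], which the left side
    absorbs. *)
Lemma norm2_le_net (e : 'cV[R]_n) c : (0 < n)%N -> 0 <= c ->
  (forall k : net, norm2 (netpt k) <= 1 -> dotv (netpt k) e <= c) -> norm2 e <= 2 * c.
Proof.
move=> n0 c0 H; suff : norm2 e <= c + 4^-1 * norm2 e by have := norm2_ge0 e; lra.
apply: norm2_le_dotv => [|v v1]; first by rewrite addr_ge0// mulr_ge0 ?norm2_ge0.
have [k [k1 kv]] := net_approx n0 v1.
rewrite -[v](subrKC (netpt k)) dotvDl lerD ?H// (le_trans (dotv_le _ _))//.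
by rewrite ler_wpM2r ?norm2_ge0.
Qed.

(** Two replacements cost a quarter of [|B|] each; absorbing the resulting half produces the factor
    2. *)
Lemma opnorm2_le_net (B : 'M[R]_n) c : (0 < n)%N -> 0 <= c ->
  (forall k l : net, norm2 (netpt k) <= 1 -> norm2 (netpt l) <= 1 ->
     dotv (netpt k) (B *m netpt l) <= c) -> opnorm2 B <= 2 * c.
Proof.
move=> n0 c0 H; have B0 := opnorm2_ge0 B.
suff : opnorm2 B <= c + 2^-1 * opnorm2 B by lra.
apply: opnorm2_le_dotv => [|u v u1 v1]; first by rewrite addr_ge0// mulr_ge0.
have [k [k1 ku]] := net_approx n0 u1; have [l [l1 lv]] := net_approx n0 v1.
have -> : dotv u (B *m v) = dotv (netpt k) (B *m netpt l) +
    (dotv (u - netpt k) (B *m v) + dotv (netpt k) (B *m (v - netpt l))).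
  by rewrite mulmxBr dotvBr dotvDl dotvNl; ring.
rewrite lerD ?H//.
have b (x y : 'cV[R]_n) a b : norm2 x <= a -> norm2 y <= b ->
    dotv x (B *m y) <= opnorm2 B * (a * b).
  move=> xa yb; rewrite (le_trans (ler_norm _))// (le_trans (opnorm2_dotv _ _ _))//.
  by rewrite ler_wpM2l// ler_pM ?norm2_ge0.
have := b _ _ _ _ ku v1; have := b _ _ _ _ k1 lv; lra.
Qed.

End Net.

(** * Exponential moments of Bernoulli vectors *)

Section ExpInequalities.
Variable R : realType.
Implicit Types x y : R.

Lemma expR_le_quad x : expR x <= 1 + x + x ^+ 2 * expR `|x|.
Proof.
have h1 : expR x - 1 <= x * expR x.
  have := ler_wpM2r (expR_ge0 x) (expR_ge1Dx (- x)).
  by rewrite expRN mulVf ?gt_eqF ?expR_gt0//; lra.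
have [x0|x0] := leP 0 x.
  rewrite ger0_norm//; have := ler_wpM2l x0 h1; lra.
have := ler_wnM2l (ltW x0) (expR_ge1Dx x).
have : 1 <= expR `|x| by rewrite (le_trans _ (expR_ge1Dx _))// lerDl.
move/(ler_wpM2l (sqr_ge0 x)); lra.
Qed.

(** The linear term averages to zero for a centred variable, leaving a purely sub-Gaussian factor.
    For [0 <= x <= 1/2] the bound follows from [expR x <= 1 / (1 - x)], and beyond [1/2] from
    [x <= 2 x^2]. *)
Lemma expR_le_sq x : expR x <= x + expR (2 * x ^+ 2).
Proof.
have b := expR_ge1Dx (2 * x ^+ 2).
have [x0|x0] := ltP x 0.
  have := ler_wnM2l (ltW x0) (expR_ge1Dx x).
  have := ler_wpM2r (expR_ge0 x) (expR_ge1Dx (- x)).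
  rewrite expRN mulVf ?gt_eqF ?expR_gt0//; have := sqr_ge0 x; lra.
have [x1|x1] := leP x 2^-1.
  have : expR x * (1 - x) <= 1.
    have := ler_wpM2r (expR_ge0 x) (expR_ge1Dx (- x)).
    by rewrite expRN mulVf ?gt_eqF ?expR_gt0//; lra.
  have x2 : 0 < 1 - x by lra.
  rewrite -ler_pdivlMr// => h; apply: le_trans h _.
  apply: (@le_trans _ _ (1 + x + 2 * x ^+ 2)); last by lra.
  rewrite ler_pdivrMr//; have : 0 <= x ^+ 2 * (1 - 2 * x) by rewrite mulr_ge0 ?sqr_ge0//; lra.
  lra.
apply: (@le_trans _ _ (expR (2 * x ^+ 2))); last by lra.
by rewrite ler_expR; have : 0 <= x * (2 * x - 1) by [rewrite mulr_ge0//; lra]; lra.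
Qed.

Lemma expR_half_le x y : expR ((x + y) / 2) <= (expR x + expR y) / 2.
Proof.
rewrite mulrDl expRD.
have e (z : R) : expR z = expR (z / 2) ^+ 2 by rewrite -expRM_natl; congr expR; field.
rewrite [in leRHS](e x) [in leRHS](e y).
have := sqr_ge0 (expR (x / 2) - expR (y / 2)); lra.
Qed.

Lemma sqr_le_expR x : 0 <= x -> x ^+ 2 <= 2 * expR x.
Proof. by move=> x0; have := expR_ge1Dxn 1 x0; rewrite (_ : 2`! = 2)//; lra. Qed.

(* [exp (y ^ 2 / 12)] is dominated by a sum of exponentials of linear functions of
   [y], which turns sub-Gaussian moment generating functions into bounds on the
   exponential moments of the square. *)
Lemma expR_sqr_le_sum y n : `|y| <= n%:R ->
  expR (y ^+ 2 / 12) <= expR 3 *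
    \sum_(k < n.+1) (expR (k%:R * y) + expR (k%:R * - y)) * expR (- (3 * k%:R ^+ 2)).
Proof.
(* The tangent to [y^2 / 12] at [6 k] is [k y - 3 k^2], and the gap is [(|y| - 6 k)^2 / 12]. This
   choice of [k] keeps [|y|] within 6 of [6 k], so the gap is at most 3, whence the factor
   [expR 3]. *)
move=> yn; pose k := Num.truncn (`|y| / 6).
have y6 : 0 <= `|y| / 6 by rewrite divr_ge0.
have kn : (k < n.+1)%N.
  rewrite truncn_lt_nat// (@le_lt_trans _ _ n%:R) ?ltr_nat//.
  have := normr_ge0 y; lra.
rewrite (bigD1 (Ordinal kn))//= mulrDr -[leLHS]addr0 lerD//; last first.
  by rewrite mulr_ge0 ?expR_ge0// sumr_ge0.
have := truncn_itv y6; rewrite -/k => /andP[k1 k2]; rewrite -[k.+1%:R]natr1 in k2.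
have -> : y ^+ 2 = `|y| ^+ 2 by rewrite real_normK ?num_real.
have h : expR (`|y| ^+ 2 / 12) <= expR 3 * (expR (k%:R * `|y|) * expR (- (3 * k%:R ^+ 2))).
  rewrite -!expRD ler_expR.
  have : 0 <= (6 - (`|y| - 6 * k%:R)) * (6 + (`|y| - 6 * k%:R)) by rewrite mulr_ge0//; lra.
  lra.
apply: le_trans h _; rewrite ler_wpM2l ?expR_ge0// ler_wpM2r ?expR_ge0//.
by have [y0|y0] := leP 0 y; [rewrite ger0_norm// lerDl | rewrite ltr0_norm// lerDr]; exact: expR_ge0.
Qed.

Lemma sum_expR_sqr_le2 n : \sum_(k < n) expR (- k%:R ^+ 2) <= 2 :> R.
Proof.
(* Term by term comparison with the geometric series of ratio [1/2], whose exact partial sum makes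
   the induction close. *)
suff : \sum_(k < n) expR (- k%:R ^+ 2) <= 2 - 2 * 2^-1 ^+ n :> R.
  by have : 0 <= 2^-1 ^+ n :> R by [rewrite exprn_ge0]; lra.
elim: n => [|n IH]; first by rewrite big_ord0 expr0; lra.
rewrite big_ord_recr/=.
have : expR (- n%:R ^+ 2) <= 2^-1 ^+ n :> R.
  rewrite exprVn expRN lef_pV2 ?posrE ?expR_gt0 ?exprn_gt0//.
  apply: (@le_trans _ _ (expR n%:R)).
    have := @expRM_natl R n 1; rewrite mulr1 => ->.
    by rewrite lerXn2r ?nnegrE ?expR_ge0//; have := expR_ge1Dx (1 : R); lra.
  by rewrite ler_expR -natrX ler_nat; case: n {IH} => // n; rewrite expnS expn1 leq_pmulr.
rewrite [2^-1 ^+ n.+1]exprS; lra.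
Qed.

End ExpInequalities.

Section ProductBernoulli.
Variables (R : realType) (N : nat) (p : 'I_N -> R).
Hypothesis p01 : forall i, 0 <= p i <= 1.
Local Notation S := {ffun 'I_N -> bool}.

(** With [p] the success probabilities at a state [x], this is the conditional expectation given
    [X_t = x]; it then unfolds to a sum against [transition]. *)
Definition berE (f : S -> R) : R := \sum_(y : S) (\prod_i bernoulli_pmf (p i) (y i)) * f y.

Definition innov (y : 'I_N -> bool) : 'cV[R]_N := \col_i ((y i)%:R - p i).

Lemma berW_ge0 (y : 'I_N -> bool) : 0 <= \prod_i bernoulli_pmf (p i) (y i).
Proof.
by apply: prodr_ge0 => i _; rewrite /bernoulli_pmf; have /andP[? ?] := p01 i; case: (y i); lra.
Qed.

Lemma le_berE f g : (forall y, f y <= g y) -> berE f <= berE g.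
Proof. by move=> fg; apply: ler_sum => y _; rewrite ler_wpM2l ?berW_ge0. Qed.

Lemma berE_sum I (r : seq I) (F : I -> S -> R) :
  berE (fun y => \sum_(i <- r) F i y) = \sum_(i <- r) berE (F i).
Proof. by rewrite exchange_big/=; apply: eq_bigr => y _; rewrite mulr_sumr. Qed.

Lemma berED f g : berE (fun y => f y + g y) = berE f + berE g.
Proof. by rewrite -big_split/=; apply: eq_bigr => y _; rewrite mulrDr. Qed.

Lemma berEZ c f : berE (fun y => c * f y) = c * berE f.
Proof. by rewrite mulr_sumr; apply: eq_bigr => y _; rewrite mulrCA. Qed.

(** Independence of the coordinates, in the form of distributivity of a product over sums. *)
Lemma berE_prod (f : 'I_N -> bool -> R) :
  berE (fun y => \prod_i f i (y i)) = \prod_i (p i * f i true + (1 - p i) * f i false).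
Proof.
transitivity (\prod_i \sum_(b : bool) bernoulli_pmf (p i) b * f i b).
  by rewrite bigA_distr_bigA/=; apply: eq_bigr => y _; rewrite big_split.
by apply: eq_bigr => i _; rewrite big_bool.
Qed.

Lemma berE1 : berE (fun=> 1) = 1.
Proof.
transitivity (berE (fun=> \prod_(i < N) 1)); first by congr berE; apply/funext => y; rewrite big1.
by rewrite (berE_prod (fun _ _ => 1)) big1// => i _; rewrite !mulr1 subrKC.
Qed.

Lemma berE_cst c : berE (fun=> c) = c.
Proof. by rewrite -{1}[c]mulr1 berEZ berE1 mulr1. Qed.

Lemma innov_norm_le1 (y : 'I_N -> bool) i : `|innov y i 0| <= 1.
Proof.
by rewrite mxE ler_norml; have /andP[? ?] := p01 i; case: (y i); rewrite /=; lra.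
Qed.

Lemma berE_innov i : berE (fun y => innov y i 0) = 0.
Proof.
(* A product test function whose factor at [i] has mean [p (1 - p) + (1 - p) (- p) = 0]. *)
pose f k (b : bool) : R := if k == i then b%:R - p k else 1.
have := berE_prod f; rewrite [RHS](bigD1 i)//= /f eqxx/=.
have -> : p i * (1 - p i) + (1 - p i) * (0 - p i) = 0 by ring.
rewrite mul0r => <-; apply: eq_bigr => y _; congr (_ * _).
by rewrite (bigD1 i)//= eqxx big1 ?mulr1 ?mxE// => k /negbTE ->.
Qed.

Lemma berE_innov2 i j : i != j -> berE (fun y => innov y i 0 * innov y j 0) = 0.
Proof.
move=> ij; pose f k (b : bool) : R := if (k == i) || (k == j) then b%:R - p k else 1.
have := berE_prod f; rewrite [RHS](bigD1 i)//= /f eqxx/=.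
have -> : p i * (1 - p i) + (1 - p i) * (0 - p i) = 0 by ring.
rewrite mul0r => <-; apply: eq_bigr => y _; congr (_ * _).
rewrite (bigD1 i)//= eqxx/= (bigD1 j)//=; last by rewrite eq_sym.
rewrite eqxx orbT big1 ?mulr1 ?mxE// => k /andP[/negbTE -> /negbTE ->].
by [].
Qed.

Lemma berE_expR_le (u : 'cV[R]_N) :
  berE (fun y => expR (dotv u (innov y))) <= expR (2 * norm2 u ^+ 2).
Proof.
pose f i (b : bool) := expR (u i 0 * (b%:R - p i)).
have -> : berE (fun y => expR (dotv u (innov y))) = berE (fun y => \prod_i f i (y i)).
  apply: eq_bigr => y _; congr (_ * _); rewrite dotvE expR_sum.
  by apply: eq_bigr => i _; rewrite mxE.
rewrite berE_prod -dotv_norm2 dotvE mulr_sumr expR_sum; apply: ler_prod => i _.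
have /andP[p0 p1] := p01 i; rewrite /f /=; apply/andP; split.
  by rewrite addr_ge0 ?mulr_ge0 ?expR_ge0//; lra.
set c := u i 0; have q0 : 0 <= 1 - p i by lra.
(* Weighted by [p] and [1 - p], the linear terms of the two bounds cancel; the quadratic exponents
   are at most [2 c^2] since [p] and [1 - p] are at most 1. *)
have := ler_wpM2l p0 (expR_le_sq (c * (1 - p i))).
have := ler_wpM2l q0 (expR_le_sq (c * (0 - p i))).
have b (z : R) : z ^+ 2 <= 1 -> expR (2 * (c * z) ^+ 2) <= expR (2 * (c * c)).
  move=> z1; rewrite ler_expR exprMn ler_wpM2l// -expr2 ler_piMr ?sqr_ge0//.
have /(ler_wpM2l p0) : expR (2 * (c * (1 - p i)) ^+ 2) <= expR (2 * (c * c)).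
  by apply: b; rewrite expr2 mulr_ile1//; lra.
have /(ler_wpM2l q0) : expR (2 * (c * (0 - p i)) ^+ 2) <= expR (2 * (c * c)).
  by apply: b; rewrite sub0r sqrrN expr2 mulr_ile1//; lra.
lra.
Qed.

(** In the sum dominating [expR (y^2 / 12)], each exponential moment of [k y] or [- k y] is at most
    [expR (2 k^2)]. Against the weight [expR (- 3 k^2)] this leaves [expR (- k^2)], of total at most
    2, once for each sign. *)
Lemma berE_expR_sqr_le (u : 'cV[R]_N) : norm2 u <= 1 ->
  berE (fun y => expR (dotv u (innov y) ^+ 2 / 12)) <= 4 * expR 3.
Proof.
move=> u1.
have dN (y : S) : `|dotv u (innov y)| <= N%:R.
  rewrite dotvE (le_trans (ler_norm_sum _ _ _))//.
  have -> : N%:R = \sum_(i < N) (1 : R) by rewrite sumr_const card_ord.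
  apply: ler_sum => i _; rewrite normrM mulr_ile1//; last exact: innov_norm_le1.
  by rewrite (le_trans (norm2_entry _ _)).
apply: le_trans (le_berE (fun y => expR_sqr_le_sum (dN y))) _.
rewrite berEZ mulrC -ler_pdivlMr ?expR_gt0// mulfK ?gt_eqF ?expR_gt0//.
rewrite -[berE _]/(berE (fun y => \sum_(k <- index_enum 'I_N.+1) _)) berE_sum/=.
apply: (@le_trans _ _ (\sum_(k < N.+1) 2 * expR (- k%:R ^+ 2))); last first.
  by rewrite -mulr_sumr; have := @sum_expR_sqr_le2 R N.+1; lra.
apply: ler_sum => k _.
have -> : berE (fun y => (expR (k%:R * dotv u (innov y)) + expR (k%:R * - dotv u (innov y))) *
    expR (- (3 * k%:R ^+ 2))) = expR (- (3 * k%:R ^+ 2)) *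
   (berE (fun y => expR (dotv (k%:R *: u) (innov y))) +
    berE (fun y => expR (dotv (- (k%:R *: u)) (innov y)))).
  rewrite -berED -berEZ; apply: eq_bigr => y _.
  by rewrite dotvNl dotvZl mulrN [_ * expR (- _)]mulrC.
have -> : expR (- k%:R ^+ 2) = expR (- (3 * k%:R ^+ 2)) * expR (2 * k%:R ^+ 2) :> R.
  by rewrite -expRD; congr expR; ring.
rewrite [leRHS]mulrCA ler_wpM2l ?expR_ge0//.
have h (v : 'cV[R]_N) : norm2 v <= k%:R -> 
    berE (fun y => expR (dotv v (innov y))) <= expR (2 * k%:R ^+ 2).
  move=> vk; apply: le_trans (berE_expR_le _) _.
  by rewrite ler_expR ler_wpM2l// lerXn2r ?nnegrE ?norm2_ge0.
have ku : norm2 (k%:R *: u) <= k%:R by rewrite norm2Z ger0_norm// ler_piMr.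
have := h (k%:R *: u) ku; have := h (- (k%:R *: u)); rewrite norm2N => /(_ ku); lra.
Qed.

(** The bilinear form of the off-diagonal part of [eps eps^T]; removing the diagonal centres it. *)
Definition quadinnov (u v : 'cV[R]_N) (y : 'I_N -> bool) : R :=
  dotv u (innov y) * dotv v (innov y) - \sum_i u i 0 * v i 0 * innov y i 0 ^+ 2.

Lemma berE_quadinnov u v : berE (quadinnov u v) = 0.
Proof.
have -> : berE (quadinnov u v) = berE (fun y => \sum_i \sum_(j | j != i)
    (u i 0 * v j 0) * (innov y i 0 * innov y j 0)).
  apply: eq_bigr => y _; congr (_ * _); rewrite /quadinnov !dotvE mulr_suml.
  rewrite -sumrB; apply: eq_bigr => i _; rewrite mulr_sumr (bigD1 i)//=.
  rewrite [X in X + _ - _](_ : _ = u i 0 * v i 0 * innov y i 0 ^+ 2); last by ring.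
  by rewrite addrC addKr; apply: eq_bigr => j _; ring.
rewrite berE_sum big1// => i _.
under eq_fun do rewrite big_mkcond/=.
rewrite berE_sum big1// => j _; case: (boolP (j != i)) => [ij|_]; last by rewrite berE_cst.
by rewrite berEZ berE_innov2 ?mulr0// eq_sym.
Qed.

Lemma normr_quadinnov_le u v y : norm2 u <= 1 -> norm2 v <= 1 ->
  `|quadinnov u v y| <= (dotv u (innov y) ^+ 2 + dotv v (innov y) ^+ 2) / 2 + 1.
Proof.
move=> u1 v1; rewrite (le_trans (ler_normB _ _))// lerD//.
  rewrite normrM -(real_normK (num_real (dotv u _))) -(real_normK (num_real (dotv v _))).
  have := sqr_ge0 (`|dotv u (innov y)| - `|dotv v (innov y)|); lra.
apply: (@le_trans _ _ (\sum_i (u i 0 * u i 0 + v i 0 * v i 0) / 2)); last first.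
  rewrite -mulr_suml big_split/= -!dotvE !dotv_norm2.
  have := norm2_ge0 u; have := norm2_ge0 v => v0 u0.
  have : norm2 u ^+ 2 <= 1 by rewrite expr_le1.
  have : norm2 v ^+ 2 <= 1 by rewrite expr_le1.
  lra.
rewrite (le_trans (ler_norm_sum _ _ _))// ler_sum// => i _.
rewrite normrM normrX; apply: (@le_trans _ _ `|u i 0 * v i 0|).
  by rewrite ler_piMr// expr_le1// innov_norm_le1.
rewrite ler_norml; have := sqr_ge0 (u i 0 - v i 0); have := sqr_ge0 (u i 0 + v i 0).
by move=> h1 h2; apply/andP; split; lra.
Qed.

(** The product of [576 * expR 1] with twice the bound [4 * expR 3] on the exponential moment of a
    square. *)
Definition Cquad : R := 4608 * expR 4.

(** In [expR_le_quad] the linear term averages to zero. The remainder [s^2 q^2 expR (s |q|)] is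
    controlled by exponentials of the squared linear forms, since [|q|] is at most half the sum of
    these squares plus 1. *)
Lemma berE_expR_quadinnov_le u v (s : R) : norm2 u <= 1 -> norm2 v <= 1 -> 0 <= s <= 24^-1 ->
  berE (fun y => expR (s * quadinnov u v y)) <= expR (Cquad * s ^+ 2).
Proof.
move=> u1 v1 /andP[s0 s1].
have H y : expR (s * quadinnov u v y) <= 1 + s * quadinnov u v y + (576 * expR 1 * s ^+ 2) *
   (expR (dotv u (innov y) ^+ 2 / 12) + expR (dotv v (innov y) ^+ 2 / 12)).
  apply: le_trans (expR_le_quad _) _; rewrite lerD2l exprMn.
  have q0 := normr_ge0 (quadinnov u v y).
  rewrite normrM (ger0_norm s0) -(real_normK (num_real (quadinnov u v y))).
  have := normr_quadinnov_le y u1 v1.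
  set q : R := `|quadinnov u v y| in q0 *; move=> qb.
  rewrite -[leLHS]mulrA [leRHS](_ : _ = s ^+ 2 * (576 * expR 1 *
     (expR (dotv u (innov y) ^+ 2 / 12) + expR (dotv v (innov y) ^+ 2 / 12)))); last by ring.
  rewrite ler_wpM2l ?sqr_ge0//.
  have x0 : 0 <= q / 24 by lra.
  have h1 := sqr_le_expR x0.
  have h2 : expR (s * q) <= expR (q / 24).
    by rewrite ler_expR mulrC ler_wpM2l.
  (* One factor [expR (q / 24)] absorbs [q^2], at the cost [2 * 24^2 = 1152]; the other absorbs
     [expR (s q)] because [s <= 1/24]. *)
  apply: (@le_trans _ _ (1152 * expR (q / 12))).
    have -> : q / 12 = q / 24 + q / 24 by field.
    rewrite expRD mulrA ler_pM ?sqr_ge0 ?expR_ge0//.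
    have -> : q ^+ 2 = 576 * (q / 24) ^+ 2 by field.
    lra.
  apply: (@le_trans _ _ (1152 * (expR 1 *
      ((expR (dotv u (innov y) ^+ 2 / 12) + expR (dotv v (innov y) ^+ 2 / 12)) / 2)))); last by lra.
  apply: ler_wpM2l; first by rewrite ler0n.
  apply: le_trans (_ : _ <= expR 1 *
      expR ((dotv u (innov y) ^+ 2 / 12 + dotv v (innov y) ^+ 2 / 12) / 2)) _.
    by rewrite -expRD ler_expR; lra.
  by rewrite ler_wpM2l ?expR_ge0// expR_half_le.
apply: le_trans (le_berE H) _; rewrite !berED berE1 !berEZ berE_quadinnov mulr0 addr0 berED.
have hu := berE_expR_sqr_le u1; have hv := berE_expR_sqr_le v1.
apply: le_trans (_ : _ <= 1 + Cquad * s ^+ 2) (expR_ge1Dx _).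
rewrite lerD2l.
apply: le_trans (_ : _ <= (576 * expR 1 * s ^+ 2) * (4 * expR 3 + 4 * expR 3)) _.
  apply: ler_wpM2l; last by rewrite lerD.
  by apply: mulr_ge0 (sqr_ge0 s); apply: mulr_ge0 (expR_ge0 1); exact: ler0n.
have e4 : expR 4 = expR 1 * expR 3 :> R by rewrite -expRD; congr expR; ring.
rewrite /Cquad e4.
by rewrite le_eqVlt; apply/orP; left; apply/eqP; ring.
Qed.

End ProductBernoulli.

(** * Stability of the linear recursion *)

Section TimeAverage.
Variables (R : realType) (T : nat).

Definition tavg (p q : nat) (F : nat -> 'M[R]_(p, q)) : 'M[R]_(p, q) :=
  T%:R^-1 *: \sum_(1 <= t < T.+1) F t.

Lemma tavgE p q (F : nat -> 'M[R]_(p, q)) i j :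
  tavg F i j = T%:R^-1 * \sum_(1 <= t < T.+1) F t i j.
Proof. by rewrite mxE summxE. Qed.

Lemma eq_tavg p q (F G : nat -> 'M[R]_(p, q)) : F =1 G -> tavg F = tavg G.
Proof. by move=> FG; congr (_ *: _); apply: eq_bigr. Qed.

Lemma tavgD p q (F G : nat -> 'M[R]_(p, q)) : tavg (fun t => F t + G t) = tavg F + tavg G.
Proof. by rewrite /tavg big_split scalerDr. Qed.

Lemma tavg_mull p q r (B : 'M[R]_(r, p)) (F : nat -> 'M[R]_(p, q)) :
  tavg (fun t => B *m F t) = B *m tavg F.
Proof. by rewrite /tavg -scalemxAr mulmx_sumr. Qed.

Lemma tavg_mulr p q r (B : 'M[R]_(q, r)) (F : nat -> 'M[R]_(p, q)) :
  tavg (fun t => F t *m B) = tavg F *m B.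
Proof. by rewrite /tavg -scalemxAl mulmx_suml. Qed.

Lemma tavg_tr p q (F : nat -> 'M[R]_(p, q)) : tavg (fun t => (F t)^T) = (tavg F)^T.
Proof. by apply/matrixP => i j; rewrite [RHS]mxE !tavgE; under eq_bigr do rewrite mxE. Qed.

Lemma tavg_shift p q (F : nat -> 'M[R]_(p, q)) :
  tavg (fun t => F t.+1) = tavg F + T%:R^-1 *: (F T.+1 - F 1%N).
Proof.
rewrite /tavg -scalerDr; congr (_ *: _).
by rewrite -(telescope_sumr F (ltn0Sn T : (1 <= T.+1)%N))// sumrB addrC subrK.
Qed.

Lemma tavg_cst p q (B : 'M[R]_(p, q)) : (0 < T)%N -> tavg (fun=> B) = B.
Proof.
move=> T0; rewrite /tavg sumr_const_nat subn1/= -[B *+ T](scaler_nat (R := R)) scalerA mulVf ?scale1r//.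
by rewrite pnatr_eq0 -lt0n.
Qed.

End TimeAverage.

(** The arithmetic closing the operator-norm contraction, with [a] for [|Delta|], [r] for the
    residual and [x] for the largest entry; denominators are cleared by powers of [lam]. *)
Lemma contraction_step (R : realFieldType) (a r x lam g s : R) :
  0 < lam < 1 -> 0 <= g -> 0 <= s -> a <= (1 - lam) * a + r + (2 * x + r) ->
  r * lam <= (38 + g) * s -> x * lam ^+ 2 <= (46 + g) * s ->
  a * lam ^+ 3 <= (168 + 4 * g) * s.
Proof.
move=> /andP[l0 l1] g0 s0 h1 h2 h3.
have h4 : a * lam <= 2 * r + 2 * x by lra.
have h5 : r * lam ^+ 2 <= (38 + g) * s.
  rewrite exprS expr1 mulrA; apply: le_trans (ler_wpM2r (ltW l0) h2) _.
  by rewrite ler_piMr ?(ltW l1)// mulr_ge0// addr_ge0.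
rewrite exprS mulrA; apply: le_trans (ler_wpM2r (exprn_ge0 2 (ltW l0)) h4) _.
by move: (lam ^+ 2) h3 h5 => q; lra.
Qed.

Section LinearRecursion.
Variables (R : realType) (N T : nat) (lam g s : R).
Variables (A Sg : 'M[R]_N) (m : 'cV[R]_N) (z e : nat -> 'cV[R]_N).
Hypotheses (N0 : (0 < N)%N) (T0 : (0 < T)%N) (lam01 : 0 < lam < 1).
Hypothesis HA : opnorm2 A <= 1 - lam.
Hypothesis Hrow : forall i, \sum_j `|A i j| <= 1 - lam.
Hypothesis Hz : forall t, z t.+1 = A *m z t + e t.
Hypothesis z1 : forall t i, `|z t i 0| <= 1.
Hypothesis e1 : forall t i, `|e t i 0| <= 1.
Hypothesis m01 : forall i, 0 <= m i 0 <= 1.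
Hypothesis zsq : forall t i,
  z t i 0 ^+ 2 = (1 - 2 * m i 0) * z t i 0 + m i 0 * (1 - m i 0).
Hypothesis Sgd : forall i, Sg i i = m i 0 * (1 - m i 0).
Hypothesis Sgo : forall i j, i != j -> Sg i j = (A *m Sg *m A^T) i j.

Local Notation avg := (tavg T).
Let S0 := avg (fun t => z t *m (z t)^T).
Let M := avg (fun t => e t *m (z t)^T).
Let E2 := avg (fun t => e t *m (e t)^T).
Let G := \matrix_(i, j) (if i == j then 0 else E2 i j) : 'M[R]_N.
Let ebar := avg e.
Let dl := avg z.
Let B := T%:R^-1 *: (z T.+1 *m (z T.+1)^T - z 1%N *m (z 1%N)^T).

Hypotheses (g0 : 0 <= g) (s0 : 0 <= s) (s1 : s <= lam / 16) (s2 : (6 + g) * s <= 1).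
Hypothesis HNT : N%:R / T%:R <= s ^+ 2.
Hypothesis HM : opnorm2 M <= 2 * (2 * s * opnorm2 S0 + s).
Hypothesis HG : opnorm2 G <= g * s.
Hypothesis He : norm2 ebar <= 6 * s.

Let Ti0 : 0 < T%:R^-1 :> R. Proof. by rewrite invr_gt0 ltr0n. Qed.

Let z_norm t : norm2 (z t) <= Num.sqrt N%:R.
Proof. by have := norm2_le_bound ler01 (z1 t); rewrite mul1r. Qed.

Let s_le1 : s <= 1. Proof. by have /andP[? ?] := lam01; move: s1; lra. Qed.

Let ss_le : s ^+ 2 <= s. Proof. by rewrite expr2 ler_piMl. Qed.

(** Each boundary outer product has norm at most [N], and [N / T <= s^2 <= s]. *)
Let opB : opnorm2 B <= 2 * s.
Proof.
have b t : norm2 (z t) * norm2 (z t) <= N%:R.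
  rewrite -[leRHS](@sqr_sqrtr R) ?ler0n// expr2.
  by rewrite ler_pM ?norm2_ge0.
apply: (@le_trans _ _ (T%:R^-1 * (2 * N%:R))); last first.
  have := HNT; have := ss_le; lra.
apply: opnorm2_le => [|x]; first by rewrite mulr_ge0 ?(ltW Ti0)// mulr_ge0.
rewrite /B -scalemxAl norm2Z (ger0_norm (ltW Ti0)) -mulrA ler_wpM2l ?(ltW Ti0)//.
rewrite (le_trans (opnorm2_ub _ _))// ler_wpM2r ?norm2_ge0//.
rewrite (le_trans (opnorm2B _ _))//.
have := opnorm2_outer (z T.+1) (z T.+1); have := opnorm2_outer (z 1%N) (z 1%N).
have := b T.+1; have := b 1%N; lra.
Qed.

(** The left side is the average of [z_{t+1} z_{t+1}^T], by the shift by one step; the right side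
    expands it with the recursion. *)
Let S0_eq : S0 + B = A *m S0 *m A^T + (A *m M^T + M *m A^T) + E2.
Proof.
rewrite -tavg_shift /S0 /M /E2.
rewrite -tavg_tr -!tavg_mull -!tavg_mulr -!tavgD; apply: eq_tavg => t.
rewrite Hz linearD/= mulmxDl !mulmxDr !trmx_mul trmxK !mulmxA.
by rewrite -!addrA; congr (_ + (_ + _)).
Qed.

Let opA1 : opnorm2 A <= 1.
Proof. by apply: le_trans HA _; have /andP[? ?] := lam01; lra. Qed.

Let R0 := A *m M^T + M *m A^T + G - B.

Let Delta := S0 - Sg.

Let opAXA X : opnorm2 (A *m X *m A^T) <= (1 - lam) * opnorm2 X.
Proof.
have a0 := opnorm2_ge0 A; have x0 := opnorm2_ge0 X.
apply: le_trans (opnorm2M _ _) _.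
apply: (@le_trans _ _ (opnorm2 (A *m X) * 1)).
  by rewrite ler_wpM2l ?opnorm2_ge0// (le_trans (opnorm2_tr_le _)).
by rewrite mulr1 (le_trans (opnorm2M _ _))// ler_wpM2r.
Qed.

Let opAM : opnorm2 (A *m M^T + M *m A^T) <= 2 * opnorm2 M.
Proof.
apply: le_trans (opnorm2D _ _) _; rewrite mulrDl !mul1r lerD//.
  rewrite (le_trans (opnorm2M _ _))//.
  rewrite -[leRHS]mul1r ler_pM ?opnorm2_ge0// opnorm2_tr_le//.
rewrite (le_trans (opnorm2M _ _))//.
by rewrite -[leRHS]mulr1 ler_pM ?opnorm2_ge0// (le_trans (opnorm2_tr_le _)).
Qed.

Let opE2 : opnorm2 E2 <= g * s + 1.
Proof.
have -> : E2 = G + (E2 - G) by rewrite subrKC.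
apply: le_trans (opnorm2D _ _) _; rewrite lerD//.
apply: opnorm2_diag => // [i j /negbTE ij|i]; first by rewrite !mxE ij subrr.
rewrite [(E2 - G) i i]mxE [(- G) i i]mxE [G i i]mxE eqxx subr0 tavgE.
rewrite normrM (ger0_norm (ltW Ti0)) mulrC ler_pdivrMr ?ltr0n// mul1r.
rewrite (le_trans (ler_norm_sum _ _ _))//.
apply: (@le_trans _ _ (\sum_(1 <= t < T.+1) 1)).
  apply: ler_sum => t _; rewrite mxE big_ord1 mxE normrM.
  by rewrite mulr_ile1.
by rewrite sumr_const_nat subn1.
Qed.

(** The bound on [M] involves [|S0|] itself: [2 |M|] contributes [8 s |S0|], at most
    [lam / 2 * |S0|] since [s <= lam / 16]. After absorption,
    [lam / 2 * |S0| <= 1 + (6 + g) s <= 2]. *)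
Let opS0 : opnorm2 S0 <= 4 / lam.
Proof.
have h : opnorm2 S0 <= (1 - lam) * opnorm2 S0 + 2 * opnorm2 M + (g * s + 1) + 2 * s.
  rewrite -{1}(addrK B S0) S0_eq (le_trans (opnorm2B _ _))// lerD//.
  rewrite (le_trans (opnorm2D _ _))// lerD//.
  by rewrite (le_trans (opnorm2D _ _))// lerD.
have := ler_wpM2r (opnorm2_ge0 S0) s1.
have /andP[l0 _] := lam01; rewrite ler_pdivlMr//.
have := HM; have := s2; lra.
Qed.

Let opM : opnorm2 M <= 18 / lam * s.
Proof.
have /andP[l0 l1] := lam01.
apply: le_trans HM _; rewrite [leRHS]mulrAC ler_pdivlMr//.
have := ler_wpM2l s0 opS0.
rewrite mulrA ler_pdivlMr//; have := ler_wpM2l s0 (ltW l1); have := s0; lra.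
Qed.

Let opR0 : opnorm2 R0 <= (38 + g) / lam * s.
Proof.
have /andP[l0 l1] := lam01.
have : opnorm2 R0 <= 2 * opnorm2 M + g * s + 2 * s.
  rewrite (le_trans (opnorm2B _ _))// lerD//.
  by rewrite (le_trans (opnorm2D _ _))// lerD.
have := opM; rewrite !(mulrAC _ _ s) !ler_pdivlMr// => h1 /(ler_wpM2r (ltW l0)).
have := ler_wpM2l (mulr_ge0 g0 s0) (ltW l1); have := ler_wpM2l s0 (ltW l1); have := s0; lra.
Qed.

Let zend : norm2 (T%:R^-1 *: (z T.+1 - z 1%N)) <= 2 * s.
Proof.
rewrite norm2Z (ger0_norm (ltW Ti0)).
have sN : Num.sqrt N%:R <= N%:R :> R.
  rewrite -{2}[N%:R](@sqr_sqrtr R) ?ler0n// expr2 ler_peMl ?sqrtr_ge0//.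
  by rewrite -[leLHS](sqrtr1 R) ler_sqrt ?ler0n// ler1n.
have : norm2 (z T.+1 - z 1%N) <= 2 * N%:R.
  rewrite (le_trans (norm2D _ _))// norm2N.
  have := z_norm T.+1; have := z_norm 1%N; lra.
move/(ler_wpM2l (ltW Ti0)); have := HNT; have := ss_le; lra.
Qed.

(** Averaging the recursion gives [dl = A dl + ebar] up to a boundary term, so
    [lam |dl| <= 6 s + 2 s]. *)
Let dl_norm : norm2 dl <= 8 / lam * s.
Proof.
have /andP[l0 l1] := lam01.
have h : dl + T%:R^-1 *: (z T.+1 - z 1%N) = A *m dl + ebar.
  by rewrite -tavg_shift -tavg_mull -tavgD; apply: eq_tavg.
have : norm2 dl <= (1 - lam) * norm2 dl + 6 * s + 2 * s.
  rewrite -{1}(addrK (T%:R^-1 *: (z T.+1 - z 1%N)) dl) h.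
  rewrite (le_trans (norm2D _ _))// norm2N lerD//.
  rewrite (le_trans (norm2D _ _))// lerD//.
  by rewrite (le_trans (opnorm2_ub _ _))// ler_wpM2r ?norm2_ge0.
by rewrite mulrAC ler_pdivlMr//; have := s0; lra.
Qed.

(** Off the diagonal [Sg] solves the same equation as [S0] without noise, and [G] agrees with [E2];
    subtraction leaves [R0]. *)
Let Delta_eq i j : i != j -> Delta i j = (A *m Delta *m A^T) i j + R0 i j.
Proof.
move=> ij; have /matrixP/(_ i j) := S0_eq.
rewrite /Delta mulmxBr mulmxBl.
have D (X Y : 'M[R]_N) : (X + Y) i j = X i j + Y i j by rewrite mxE.
have O (X : 'M[R]_N) : (- X) i j = - X i j by rewrite mxE.
have G0 : G i j = E2 i j by rewrite [G i j]mxE (negbTE ij).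
by rewrite /R0 !(D, O) Sgo// G0; lra.
Qed.

Let Delta_diag i : `|Delta i i| <= norm2 dl.
Proof.
apply: le_trans (norm2_entry _ i).
have -> : Delta i i = (1 - 2 * m i 0) * dl i 0.
  rewrite [Delta i i]mxE [(- Sg) i i]mxE Sgd !tavgE.
  under eq_bigr do rewrite mxE big_ord1 [(_^T) _ _]mxE -expr2 zsq.
  rewrite big_split/= -mulr_sumr sumr_const_nat subn1/= mulrDr.
  rewrite -[(m i 0 * (1 - m i 0)) *+ T]mulr_natl mulKf ?pnatr_eq0 -?lt0n//; ring.
rewrite normrM ler_piMl// ler_norml; have /andP[? ?] := m01 i; lra.
Qed.

(** The maximum is attained, so the recursion can be applied at the maximising entry. *)
Let mx_max : exists x : R, 0 <= x /\ (forall i j, `|Delta i j| <= x) /\ exists i j, x = `|Delta i j|.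
Proof.
have i0 : 'I_N := Ordinal N0.
pose p := [arg max_(p > (i0, i0)) `|Delta p.1 p.2|]%O.
exists `|Delta p.1 p.2|; split; first exact: normr_ge0.
split; last by exists p.1, p.2.
move=> i j; rewrite /p; case: arg_maxP => // q _ h; exact: (h (i, j)).
Qed.

(** Absolute row sums control both multiplications by [A] in the maximum norm; the left one is
    bounded by 1, and the factor [1 - lam] comes from the right one. *)
Let entry_bound x i j : (forall i j, `|Delta i j| <= x) ->
  `|(A *m Delta *m A^T) i j| <= (1 - lam) * x.
Proof.
move=> Hx; have x0 : 0 <= x by apply: le_trans (Hx i i).
have /andP[l0 l1] := lam01; have l2 : 0 <= 1 - lam by lra.
have h1 k : `|(A *m Delta) i k| <= x.
  rewrite mxE (le_trans (ler_norm_sum _ _ _))//.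
  apply: (@le_trans _ _ (\sum_j0 `|A i j0| * x)).
    by apply: ler_sum => l _; rewrite normrM ler_wpM2l.
  by rewrite -mulr_suml ler_piMl//; have := Hrow i; lra.
rewrite mxE (le_trans (ler_norm_sum _ _ _))//.
apply: (@le_trans _ _ (\sum_k `|A j k| * x)).
  by apply: ler_sum => l _; rewrite normrM mulrC [(_^T) _ _]mxE ler_wpM2l.
by rewrite -mulr_suml ler_wpM2r.
Qed.

Let Delta_max : exists x : R, (forall i j, `|Delta i j| <= x) /\ x <= (46 + g) / lam ^+ 2 * s.
Proof.
have /andP[l0 l1] := lam01.
have [x [x0 [Hx [i [j xE]]]]] := mx_max; exists x; split => //.
rewrite mulrAC ler_pdivlMr ?exprn_gt0//.
(* A maximiser on the diagonal is bounded by [|dl|]; one off the diagonal satisfies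
   [x <= (1 - lam) x + |R0|]. The sum of the two bounds covers both cases. *)
have b : x * lam <= (38 + g) / lam * s + 8 / lam * s.
  have [ij|ij] := eqVneq i j.
    have := Delta_diag i; rewrite {2}ij -xE => h.
    have := dl_norm; have := opR0; have := opnorm2_ge0 R0; have := ler_wpM2l x0 (ltW l1); lra.
  have := entry_bound i j Hx; have := opnorm2_entry R0 i j; have := opR0.
  have : x <= `|(A *m Delta *m A^T) i j| + `|R0 i j|.
    by rewrite xE Delta_eq// ler_normD.
  have := norm2_ge0 dl; have := dl_norm; lra.
move: b; rewrite !(mulrAC _ _ s) -mulrDl ler_pdivlMr//; lra.
Qed.

(** By [Delta_eq], [Delta - A Delta A^T - R0] is diagonal, so its operator norm is its largest entry
    and the entrywise bound loses no factor of [N]. The operator-norm contraction then applies. *)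
Let opDelta : opnorm2 Delta <= (168 + 4 * g) / lam ^+ 3 * s.
Proof.
have /andP[l0 l1] := lam01.
have [x [Hx xb]] := Delta_max.
have x0 : 0 <= x by apply: le_trans (Hx (Ordinal N0) (Ordinal N0)).
have h : opnorm2 (Delta - (A *m Delta *m A^T + R0)) <= 2 * x + opnorm2 R0.
  apply: opnorm2_diag => [|i j ij|i].
  - by rewrite addr_ge0 ?mulr_ge0 ?opnorm2_ge0.
  - by rewrite [LHS]mxE [X in _ + X]mxE [X in _ - X]mxE Delta_eq// subrr.
  have -> : (Delta - (A *m Delta *m A^T + R0)) i i =
      Delta i i - ((A *m Delta *m A^T) i i + R0 i i).
    by rewrite [LHS]mxE [X in _ + X]mxE [X in _ - X]mxE.
  rewrite (le_trans (ler_normB _ _))//.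
  have := ler_normD ((A *m Delta *m A^T) i i) (R0 i i).
  have := Hx i i; have := entry_bound i i Hx; have := opnorm2_entry R0 i i.
  have := ler_wpM2r x0 (ltW l0); lra.
have : opnorm2 Delta <= (1 - lam) * opnorm2 Delta + opnorm2 R0 + (2 * x + opnorm2 R0).
  rewrite -{1}(subrK (A *m Delta *m A^T + R0) Delta) addrC.
  rewrite (le_trans (opnorm2D _ _))// lerD//.
  by rewrite (le_trans (opnorm2D _ _))// lerD.
move: xb opR0; rewrite !(mulrAC _ _ s) !ler_pdivlMr ?exprn_gt0// => xb rb hh.
exact: (contraction_step lam01 g0 s0 hh rb xb).
Qed.

Lemma linear_recursion_bound :
  opnorm2 (avg (fun t => (z t.+1 - dl) *m (z t - dl)^T) - A *m Sg) <=
  (266 + 4 * g) / lam ^+ 3 * s.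
Proof.
have /andP[l0 l1] := lam01.
pose dl' := avg (fun t => z t.+1).
(* Both factors are centred at [dl], so the correction is [- dl' dl^T - dl dl^T + dl dl^T], of which
   only the first term survives. *)
have h : avg (fun t => (z t.+1 - dl) *m (z t - dl)^T) = A *m S0 + M - dl' *m dl^T.
  rewrite /S0 /M -tavg_mull -tavgD.
  have -> : avg (fun t => (z t.+1 - dl) *m (z t - dl)^T) =
     avg (fun t => z t.+1 *m (z t)^T + (z t.+1 *m (- dl^T) + ((- dl) *m (z t)^T + dl *m dl^T))).
    apply: eq_tavg => t; rewrite linearB/= mulmxDl !mulmxDr -!addrA; congr (_ + (_ + (_ + _))).
    by rewrite mulmxN mulNmx opprK.
  have c1 : avg (fun t => z t.+1 *m (- dl^T)) = dl' *m (- dl^T) by exact: tavg_mulr.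
  have c2 : avg (fun t => (- dl) *m (z t)^T) = (- dl) *m dl^T by rewrite tavg_mull tavg_tr.
  rewrite [LHS]tavgD [X in _ + X]tavgD [X in _ + (_ + X)]tavgD c1 c2 tavg_cst//.
  rewrite mulNmx addNr addr0 mulmxN; congr (_ - _); apply: eq_tavg => t.
  by rewrite Hz mulmxDl mulmxA.
have -> : avg (fun t => (z t.+1 - dl) *m (z t - dl)^T) - A *m Sg = A *m Delta + M - dl' *m dl^T.
  by rewrite h /Delta mulmxBr -!addrA; congr (_ + _); rewrite [RHS]addrC !addrA.
have d' : norm2 dl' <= 8 / lam * s + 2 * s.
  by rewrite /dl' tavg_shift (le_trans (norm2D _ _))// lerD.
(* A product of two terms of order [s], reduced to order [s] by [s^2 <= s]; the final constant is
   [266 = 168 + 18 + 80]. *)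
have dd : norm2 dl' * norm2 dl <= 80 / lam ^+ 2 * s.
  apply: (@le_trans _ _ ((10 / lam * s) * (8 / lam * s))).
    rewrite ler_pM ?norm2_ge0//; apply: le_trans d' _.
    rewrite -mulrDl ler_wpM2r// ler_pdivlMr// mulrDl divfK ?gt_eqF//; lra.
  have -> : 10 / lam * s * (8 / lam * s) = 80 / lam ^+ 2 * s ^+ 2.
    by field; rewrite gt_eqF.
  by rewrite ler_wpM2l// divr_ge0// exprn_ge0// ltW.
have i1 : 1 <= lam^-1 by rewrite invf_ge1 ?ltW.
have a1 : opnorm2 (A *m Delta) <= opnorm2 Delta.
  by rewrite (le_trans (opnorm2M _ _))// ler_piMl ?opnorm2_ge0.
have : opnorm2 (A *m Delta + M - dl' *m dl^T) <= opnorm2 Delta + 18 / lam * s + 80 / lam ^+ 2 * s.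
  rewrite (le_trans (opnorm2B _ _))// lerD//.
    by rewrite (le_trans (opnorm2D _ _))// lerD.
  by rewrite (le_trans (opnorm2_outer _ _)).
move=> hh; apply: le_trans hh _.
have e3 : 80 / lam ^+ 2 * s <= 80 / lam ^+ 3 * s.
  rewrite ler_wpM2r// ler_wpM2l// -!exprVn [lam^-1 ^+ 3]exprS ler_peMl// exprn_ge0// invr_ge0 ltW//.
have e2 : 18 / lam * s <= 18 / lam ^+ 3 * s.
  rewrite ler_wpM2r// ler_wpM2l// -exprVn exprS ler_peMr ?invr_ge0 ?(ltW l0)// exprn_ege1//.
have -> : (266 + 4 * g) / lam ^+ 3 * s =
    (168 + 4 * g) / lam ^+ 3 * s + 18 / lam ^+ 3 * s + 80 / lam ^+ 3 * s.
  by rewrite -!mulrDl; congr (_ / _ * _); ring.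
by rewrite !lerD.
Qed.

End LinearRecursion.

(** * Exponential bounds for the chain *)

Section FiniteProbability.
Context d (Omega : measurableType d) (R : realType) (P : probability Omega R).
Implicit Types E F : set Omega.

Definition pr E : R := fine (P E).

Lemma prE E : measurable E -> (pr E)%:E = P E.
Proof. by move=> mE; rewrite /pr fineK// fin_num_measure. Qed.

Lemma pr_ge0 E : 0 <= pr E. Proof. exact: fine_ge0. Qed.

Lemma prT : pr setT = 1. Proof. by rewrite /pr probability_setT. Qed.

Lemma pr0 : pr set0 = 0. Proof. by rewrite /pr measure0. Qed.

Lemma pr_mono E F : measurable E -> measurable F -> E `<=` F -> pr E <= pr F.
Proof. by move=> mE mF EF; rewrite -lee_fin !prE// le_measure ?inE. Qed.

Lemma prU E F : measurable E -> measurable F -> E `&` F = set0 -> pr (E `|` F) = pr E + pr F.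
Proof.
move=> mE mF EF; apply: EFin_inj; rewrite EFinD !prE//; last exact: measurableU.
exact: measureU.
Qed.

Lemma prU_le E F : measurable E -> measurable F -> pr (E `|` F) <= pr E + pr F.
Proof.
move=> mE mF; rewrite -lee_fin EFinD !prE//; last exact: measurableU.
exact: measureU2.
Qed.

Lemma pr_union_le (I : finType) (F : I -> set Omega) E : measurable E ->
  (forall i, measurable (F i)) -> (forall w, E w -> exists i, F i w) ->
  pr E <= \sum_i pr (F i).
Proof.
move=> mE mF EF; have h (r : seq I) : pr (\big[setU/set0]_(i <- r) F i) <= \sum_(i <- r) pr (F i).
  elim: r => [|i r IH]; first by rewrite !big_nil pr0.
  rewrite !big_cons (le_trans (prU_le _ _))//; first exact: bigsetU_measurable.
  by rewrite lerD2l.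
apply: le_trans (h _); apply: pr_mono => //; first exact: bigsetU_measurable.
by move=> w /EF[i Fi]; rewrite (bigD1 i)//=; left.
Qed.

Lemma pr_partition (U : finType) (Y : Omega -> U) E : measurable E ->
  (forall u, measurable [set w | Y w = u]) ->
  pr E = \sum_u pr (E `&` [set w | Y w = u]).
Proof.
move=> mE mY.
have h (r : seq U) : uniq r ->
    pr (E `&` [set w | Y w \in r]) = \sum_(u <- r) pr (E `&` [set w | Y w = u]) /\
    measurable [set w | Y w \in r].
  elim: r => [_|u r IH /= /andP[ur uq]].
    rewrite big_nil (_ : [set w | Y w \in [::]] = set0) ?setI0 ?pr0//.
    by rewrite -subset0 => w.
  have [e m] := IH uq.
  have -> : [set w | Y w \in u :: r] = [set w | Y w = u] `|` [set w | Y w \in r].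
    apply/seteqP; split=> w /=; rewrite inE.
      by case/orP => [/eqP|]; [left | right].
    by case=> [->|->]; rewrite ?eqxx ?orbT.
  split; last exact: measurableU.
  rewrite setIUr big_cons prU ?e//; [exact: measurableI|exact: measurableI|].
  by rewrite -subset0 => w [[_ /= ->] [_ /=]]; rewrite (negbTE ur).
have [<- _] := h _ (index_enum_uniq U); congr pr; apply/seteqP; split=> w /=.
  by move=> Ew; split => //; rewrite mem_index_enum.
by case.
Qed.

End FiniteProbability.

Lemma sum_tupleS (R : realType) (S : finType) (n : nat) (F : seq S -> R) :
  \sum_(p : n.+1.-tuple S) F p = \sum_(p : n.-tuple S) \sum_(y : S) F (y :: p).
Proof.
rewrite pair_bigA/=.
rewrite (reindex (fun q : n.-tuple S * S => [tuple of q.2 :: q.1]))//=.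
exists (fun p : n.+1.-tuple S => ([tuple of behead p], thead p)) => [[p y] _|p _] /=.
  by congr (_, _); apply: val_inj.
by rewrite [RHS]tuple_eta; apply: val_inj.
Qed.

Section Chain.
Context d (Omega : measurableType d) (R : realType) (P : probability Omega R) (N : nat).
Variables (X : 'I_N -> int -> {RV P >-> bool}) (lambda mu : R) (Pp Pm : {set 'I_N}).
Variable theta : 'M[bool]_N.
Hypothesis HX : stationary_chain X lambda mu Pp Pm theta.
Local Notation S := {ffun 'I_N -> bool}.
Local Notation pr := (pr P).

Local Notation K := (transition lambda mu Pp Pm theta).

Definition state (t : int) (w : Omega) : S := [ffun i => X i t w].

Lemma at_stateE (t : int) (y : S) : at_state X t y = [set w | state t w = y].
Proof.
apply/seteqP; split=> w /= h; first by apply/ffunP => i; rewrite ffunE.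
by move=> i; rewrite -h ffunE.
Qed.

Lemma measurable_state (t : int) (y : S) : measurable [set w | state t w = y].
Proof.
rewrite (_ : mkset _ = \bigcap_(i in [set: 'I_N]) (X i t @^-1` [set y i])).
  by apply: fin_bigcap_measurable => // i _; apply: measurable_funPTI.
rewrite -at_stateE; apply/seteqP; split=> w /= h i; first by move=> _; exact: h.
exact: (h i I).
Qed.

(** The path [X_n, ..., X_1] with the latest state first, as in [history], so that a new step is a
    cons. *)
Fixpoint walk (n : nat) (w : Omega) : seq S :=
  if n is n'.+1 then state n w :: walk n' w else [::].

Lemma size_walk n w : size (walk n w) = n.
Proof. by elim: n => //= n ->. Qed.

Definition walkt n w : n.-tuple S := Tuple (introT eqP (size_walk n w)).

Lemma measurable_walk n (p : seq S) : measurable [set w | walk n w = p].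
Proof.
elim: n p => [|n IH] [|y p] /=.
- by rewrite (_ : mkset _ = setT)//; apply/seteqP; split.
- by rewrite (_ : mkset _ = set0)//; apply/seteqP; split.
- by rewrite (_ : mkset _ = set0)//; apply/seteqP; split.
rewrite (_ : mkset _ = [set w | state n.+1 w = y] `&` [set w | walk n w = p]).
  by apply: measurableI => //; exact: measurable_state.
by apply/seteqP; split=> w /= [-> ->].
Qed.

Lemma measurable_walkt n (p : n.-tuple S) : measurable [set w | walkt n w = p].
Proof.
rewrite (_ : mkset _ = [set w | walk n w = p]); first exact: measurable_walk.
by apply/seteqP; split=> w /= h; [rewrite -h | exact: val_inj].
Qed.

(** There are finitely many paths of length [n], so such an event is a finite union of path
    events. *)
Lemma measurable_of_walk n (E : set Omega) :
  (forall w w', walk n w = walk n w' -> E w -> E w') -> measurable E.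
Proof.
move=> H; rewrite (_ : E = \bigcup_(p in [set p | exists2 w, E w & walkt n w = p])
   [set w | walkt n w = p]).
  apply: fin_bigcup_measurable => [|p _]; first exact: finite_finset.
  exact: measurable_walkt.
apply/seteqP; split=> w /=; first by move=> Ew; exists (walkt n w) => //; exists w.
by case=> p [w' Ew' <-] /= h; apply: H Ew'; have := congr1 val h.
Qed.

Lemma walk_history n (p : seq S) (x0 : S) : size p = n.+1 ->
  [set w | walk n.+1 w = p] = history X n.+1 n (fun l => nth x0 p l).
Proof.
move=> sp.
have nw (k l : nat) w : (l < k)%N -> nth x0 (walk k w) l = state (k%:Z - l%:Z) w.
  elim: k l => // k IH [_|l lk] /=; first by rewrite subr0.
  by rewrite IH//; congr state; lia.
apply/seteqP; split=> w /=.
  by move=> <- l ln; rewrite at_stateE; symmetry; exact: (nw n.+1).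
move=> h; change (walk n.+1 w = p); apply: (@eq_from_nth _ x0); rewrite size_walk ?sp// => l ln.
by rewrite nw//; have := h l ln; rewrite at_stateE.
Qed.

Lemma pr_walkS n (p : seq S) (x0 y : S) : size p = n.+1 ->
  pr [set w | walk n.+2 w = y :: p] = pr [set w | walk n.+1 w = p] * K (nth x0 p 0) y.
Proof.
move=> sp; have := HX.1 n.+2%:Z n (fun l => nth x0 p l) y.
have -> : n.+2%:Z - 1 = n.+1%:Z by lia.
rewrite -(walk_history x0 sp) at_stateE => h.
have -> : [set w | walk n.+2 w = y :: p] =
    [set w | walk n.+1 w = p] `&` [set w | state n.+2 w = y].
  by apply/seteqP; split=> w /= [-> ->].
apply: EFin_inj; rewrite EFinM !prE ?h//; first exact: measurable_walk.
by apply: measurableI; [exact: measurable_walk | exact: measurable_state].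
Qed.

(** * Chernoff bound for additive functionals of the chain *)

Section Chernoff.
Variable g : S -> S -> R.
Hypothesis Hg : forall x : S, \sum_(y : S) K x y * expR (g x y) <= 1.

Fixpoint addf (p : seq S) : R :=
  if p is y :: p' then (if p' is x :: _ then g x y + addf p' else 0) else 0.

Lemma addf_walk n w :
  addf (walk n.+1 w) = \sum_(1 <= t < n.+1) g (state t w) (state t.+1 w).
Proof.
elim: n => [|n IH]; first by rewrite big_geq.
rewrite big_nat_recr//= addrC -IH.
by [].
Qed.

(** The supermartingale property, path by path: given [p], the new factor has conditional mean at
    most 1 by [Hg]. *)
Lemma addf_step n (p : seq S) : size p = n.+1 ->
  \sum_(y : S) pr [set w | walk n.+2 w = y :: p] * expR (addf (y :: p)) <=
  pr [set w | walk n.+1 w = p] * expR (addf p).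
Proof.
case: p => [//|x p] sp.
have -> : \sum_(y : S) pr [set w | walk n.+2 w = y :: x :: p] * expR (addf (y :: x :: p)) =
    pr [set w | walk n.+1 w = x :: p] * expR (addf (x :: p)) *
    \sum_(y : S) K x y * expR (g x y).
  rewrite mulr_sumr; apply: eq_bigr => y _; rewrite (pr_walkS x _ sp).
  rewrite -[addf (y :: _)]/(g x y + addf (x :: p)) expRD -[nth _ _ _]/x; ring.
by rewrite ler_piMr ?mulr_ge0 ?expR_ge0 ?pr_ge0.
Qed.

Lemma expect_addf_le1 n :
  \sum_(p : n.+1.-tuple S) pr [set w | walk n.+1 w = p] * expR (addf p) <= 1.
Proof.
elim: n => [|n IH].
  rewrite -(prT P) (pr_partition P (Y := walkt 1) measurableT); last exact: measurable_walkt.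
  apply: ler_sum => p _; rewrite setTI.
  have -> : addf p = 0 by case: p => [[|x [|y p]]].
  rewrite expR0 mulr1 le_eqVlt; apply/orP; left; apply/eqP; congr pr.
  by apply/seteqP; split=> w /= [h]; [apply: val_inj; rewrite /= h|rewrite -h].
apply: le_trans IH.
rewrite (@sum_tupleS _ _ _ (fun p => pr [set w | walk n.+2 w = p] * expR (addf p))).
by apply: ler_sum => p _; apply: addf_step; rewrite size_tuple.
Qed.

Lemma chain_chernoff n a :
  pr [set w | a <= \sum_(1 <= t < n.+1) g (state t w) (state t.+1 w)] <= expR (- a).
Proof.
have mE : measurable [set w | a <= \sum_(1 <= t < n.+1) g (state t w) (state t.+1 w)].
  apply: (@measurable_of_walk n.+1) => w w' ww /=.
  by rewrite -!addf_walk ww.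
rewrite (pr_partition P mE (@measurable_walkt n.+1)).
apply: (@le_trans _ _ (expR (- a) *
   \sum_(p : n.+1.-tuple S) pr [set w | walk n.+1 w = p] * expR (addf p))); last first.
  by rewrite ler_piMr ?expR_ge0// expect_addf_le1.
rewrite mulr_sumr; apply: ler_sum => p _.
rewrite mulrCA -expRD.
(* Markov's inequality on each path: either [expR (addf p - a) >= 1], or the path does not meet the
   event. *)
have [ap|ap] := leP a (addf p).
  apply: (@le_trans _ _ (pr [set w | walk n.+1 w = p])); last first.
    by rewrite ler_peMr ?pr_ge0// -(expR0 R) ler_expR; lra.
  apply: pr_mono; [|exact: measurable_walk|by move=> w [_ /= <-]].
  by apply: measurableI => //; exact: measurable_walkt.
rewrite (_ : _ `&` _ = set0) ?pr0 ?mulr_ge0 ?expR_ge0 ?pr_ge0//.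
rewrite -subset0 => w [/=]; rewrite -addf_walk => h wp; move: ap.
by rewrite -wp ltNge h.
Qed.

End Chernoff.

Definition pi0 (x : S) : R := pr [set w | state 0 w = x].

Lemma pr_state (t : int) (x : S) : pr [set w | state t w = x] = pi0 x.
Proof.
have H (r : int) : history X r 0 (fun=> x) = [set w | state r w = x].
  rewrite -at_stateE; apply/seteqP; split=> w h; first by have := h 0%N isT; rewrite subr0.
  by move=> [|//] _; rewrite subr0.
have := HX.2 0 t 0%N (fun=> x); rewrite !H add0r => h.
by apply: EFin_inj; rewrite !prE ?h//; exact: measurable_state.
Qed.

Lemma pr_state2 (x y : S) :
  pr ([set w | state 0 w = x] `&` [set w | state 1 w = y]) = pi0 x * K x y.
Proof.
have H (r : int) : history X r 0 (fun=> x) = [set w | state r w = x].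
  rewrite -at_stateE; apply/seteqP; split=> w h; first by have := h 0%N isT; rewrite subr0.
  by move=> [|//] _; rewrite subr0.
have := HX.1 1 0%N (fun=> x) y; rewrite subrr H at_stateE => h.
apply: EFin_inj; rewrite EFinM !prE ?h//; first exact: measurable_state.
by apply: measurableI; exact: measurable_state.
Qed.

Lemma pi0_ge0 x : 0 <= pi0 x. Proof. exact: pr_ge0. Qed.

Lemma sum_pi0 : \sum_x pi0 x = 1.
Proof.
rewrite -(prT P) (pr_partition P (Y := state 0) measurableT); last exact: measurable_state.
by apply: eq_bigr => x _; rewrite setTI.
Qed.

Lemma pi0_stationary (y : S) : \sum_(x : S) pi0 x * K x y = pi0 y.
Proof.
rewrite -(pr_state 1) (pr_partition P (Y := state 0)); [|exact: measurable_state..].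
by apply: eq_bigr => x _; rewrite setIC pr_state2.
Qed.

Lemma expectation_state f : \sum_(y : S) pi0 y * f y =
  \sum_(x : S) pi0 x * \sum_(y : S) K x y * f y.
Proof.
under [LHS]eq_bigr do rewrite -pi0_stationary mulr_suml.
rewrite exchange_big/=; apply: eq_bigr => x _.
by rewrite mulr_sumr; apply: eq_bigr => y _; rewrite mulrA.
Qed.

Let measurableX i t : measurable [set w | X i t w = true].
Proof. exact: (measurable_funPTI (X i t) (Y := [set true])). Qed.

Lemma pr_coord (t : int) i : pr [set w | X i t w = true] = \sum_(x : S) pi0 x * (x i)%:R.
Proof.
rewrite (pr_partition P (Y := state t) (measurableX i t)); last exact: measurable_state.
apply: eq_bigr => x _; rewrite -(pr_state t); case: (boolP (x i)) => xi; last first.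
  rewrite mulr0 (_ : _ `&` _ = set0) ?pr0// -subset0 => w [/= h e].
  by move: xi; rewrite -e ffunE h.
rewrite mulr1; congr pr; apply/seteqP; split=> w /=; first by case.
by move=> e; split => //; rewrite -xi -e ffunE.
Qed.

Lemma pr_coord2 i j : pr ([set w | X i 1 w = true] `&` [set w | X j 0 w = true]) =
  \sum_(x : S) \sum_(y : S) pi0 x * K x y * ((y i)%:R * (x j)%:R).
Proof.
have m2 : measurable ([set w | X i 1 w = true] `&` [set w | X j 0 w = true]).
  exact: measurableI.
rewrite (pr_partition P (Y := state 0) m2); last exact: measurable_state.
apply: eq_bigr => x _.
rewrite (pr_partition P (Y := state 1)); [|
  exact: (measurableI _ _ m2 (measurable_state _ _))|exact: measurable_state].
apply: eq_bigr => y _; rewrite -pr_state2; case: (boolP (y i && x j)) => [/andP[yi xj]|yx].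
  rewrite yi xj !mulr1; congr pr; apply/seteqP; split=> w /=; first by move=> [[_ ->] ->].
  by move=> [e1 e2]; do 3 split => //; [rewrite -yi -e2 ffunE|rewrite -xj -e1 ffunE].
rewrite -natrM mulnb (negbTE yx) mulr0 (_ : _ `&` _ = set0) ?pr0// -subset0 => w [[[/= h1 h2] e1] e2].
by move: yx; rewrite -e1 -e2 !ffunE h1 h2.
Qed.

(** Boolean coordinates are indicators, so the covariance reduces to probabilities of events, which
    are finite sums over the states at times 0 and 1. *)
Lemma Sigma1E i j : Sigma1 X i j =
  \sum_(x : S) pi0 x * (\sum_(y : S) K x y * (y i)%:R) * (x j)%:R -
  (\sum_(x : S) pi0 x * (x i)%:R) * (\sum_(x : S) pi0 x * (x j)%:R).
Proof.
have ind k t : (fun w => (X k t w)%:R) = \1_[set w | X k t w = true] :> (Omega -> R).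
  apply/funext => w; rewrite indicE; case: (boolP (X k t w)) => h.
    by rewrite mem_set.
  by rewrite memNset//=; exact/negP.
have L E : measurable E -> (\1_E : Omega -> R) \in Lfun P 1.
  by move=> mE; apply/Lfun1_integrable; exact: integrable_indic.
have M : \1_[set w | X i 1 w = true] * \1_[set w | X j 0 w = true] =
   \1_([set w | X i 1 w = true] `&` [set w | X j 0 w = true]) :> (Omega -> R).
  by rewrite indicI.
have m2 : measurable ([set w | X i 1 w = true] `&` [set w | X j 0 w = true]).
  exact: measurableI.
rewrite mxE !ind covarianceE ?M ?L// !expectation_indic// -!prE//.
rewrite /= !pr_coord pr_coord2; congr (_ - _); apply: eq_bigr => x _.
rewrite mulr_sumr mulr_suml; apply: eq_bigr => y _; ring.
Qed.

End Chain.

(** * The chain as a vector autoregression *)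

Section Model.
Context d (Omega : measurableType d) (R : realType) (P : probability Omega R) (N : nat).
Variables (X : 'I_N -> int -> {RV P >-> bool}) (lambda mu : R) (Pp Pm : {set 'I_N}).
Variable theta : 'M[bool]_N.
Hypothesis N0 : (0 < N)%N.
Hypothesis lambda01 : 0 < lambda < 1.
Hypothesis mu_le : 0 < mu <= lambda.
Hypothesis PpmU : (Pp :|: Pm)%SET = finset.setT.
Hypothesis PpmI : (Pp :&: Pm)%SET = finset.set0.
Hypothesis HX : stationary_chain X lambda mu Pp Pm theta.
Local Notation S := {ffun 'I_N -> bool}.
Local Notation pr := (pr P).
Local Notation K := (transition lambda mu Pp Pm theta).
Local Notation ptheta := (ptheta lambda mu Pp Pm theta).
Local Notation pi0 := (pi0 X).

Let mem_Pm j : (j \in Pm) = (j \notin Pp).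
Proof.
have /setP/(_ j) := PpmU; have /setP/(_ j) := PpmI.
by rewrite !inE; case: (j \in Pp); case: (j \in Pm).
Qed.

(** Since [theta (1 - x) = theta - theta x], members of [Pm] enter with sign [-1] and their constant
    part goes to [intercept]. *)
Definition drift : 'M[R]_N := \matrix_(i, j)
  ((1 - lambda) * (N%:R^-1 * ((theta i j)%:R * (if j \in Pp then 1 else -1)))).

Definition intercept : 'cV[R]_N := \col_i
  (mu + (1 - lambda) * (N%:R^-1 * \sum_(j in Pm) (theta i j)%:R)).

Definition bvec (x : 'I_N -> bool) : 'cV[R]_N := \col_i (x i)%:R.

Let Nr0 : 0 < N%:R :> R. Proof. by rewrite ltr0n. Qed.

Lemma ptheta_affine x i : ptheta x i = (intercept + drift *m bvec x) i 0.
Proof.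
rewrite [RHS]mxE [X in X + _]mxE [X in _ + X]mxE /Defs.ptheta -addrA -mulrDr; congr (_ + _).
have -> : \sum_j drift i j * bvec x j 0 = (1 - lambda) * (N%:R^-1 *
    \sum_j ((theta i j)%:R * (if j \in Pp then 1 else -1) * (x j)%:R)).
  by rewrite !mulr_sumr; apply: eq_bigr => j _; rewrite !mxE !mulrA.
rewrite -!mulrDr; congr (_ * (_ * _)).
rewrite [X in _ = _ + X](bigID (mem Pp))/= addrCA; congr (_ + _).
  by apply: eq_bigr => j ->; rewrite mulr1.
rewrite [X in _ = _ + X](eq_bigl (mem Pm)) => [|j]; last by rewrite /= mem_Pm.
rewrite -big_split/=; apply: eq_bigr => j; rewrite mem_Pm => /negbTE ->; ring.
Qed.

Lemma ptheta01 x i : 0 <= ptheta x i <= 1.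
Proof.
have /andP[l0 l1] := lambda01; have /andP[m0 ml] := mu_le.
pose F j : R := (theta i j)%:R * (if j \in Pp then (x j)%:R else 1 - (x j)%:R).
have -> : ptheta x i = mu + (1 - lambda) * (N%:R^-1 * \sum_j F j).
  rewrite /Defs.ptheta -mulrDr; congr (_ + _ * (_ * _)).
  rewrite [RHS](bigID (mem Pp))/=; congr (_ + _).
    by apply: eq_bigr => j jp; rewrite /F jp.
  rewrite (eq_bigl (fun j => j \notin Pp)) => [|j]; last exact: mem_Pm.
  by apply: eq_bigr => j /negbTE jp; rewrite /F jp.
have F01 j : 0 <= F j <= 1.
  by rewrite /F; case: (theta i j); case: ifP; case: (x j); rewrite /=; lra.
have F0 : 0 <= \sum_j F j by apply: sumr_ge0 => j _; have /andP[] := F01 j.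
have F1 : N%:R^-1 * \sum_j F j <= 1.
  rewrite mulrC ler_pdivrMr// mul1r.
  have -> : N%:R = \sum_(j < N) (1 : R) by rewrite sumr_const card_ord.
  by apply: ler_sum => j _; have /andP[] := F01 j.
have F2 : 0 <= N%:R^-1 * \sum_j F j by rewrite mulr_ge0// invr_ge0 ltW.
have l2 : 0 <= 1 - lambda by lra.
apply/andP; split; first by rewrite addr_ge0 ?mulr_ge0// ltW.
have := ler_wpM2l l2 F1; lra.
Qed.

Lemma drift_entry i j : `|drift i j| <= (1 - lambda) / N%:R.
Proof.
have /andP[l0 l1] := lambda01; have l2 : 0 <= 1 - lambda by lra.
rewrite mxE normrM (ger0_norm l2) ler_wpM2l// normrM ger0_norm ?invr_ge0 ?(ltW Nr0)//.
rewrite ler_piMr ?invr_ge0 ?(ltW Nr0)//.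
by case: (theta i j); case: ifP => _ /=; rewrite ?mul1r ?mul0r ?normrN1 ?normr1 ?normr0.
Qed.

Lemma drift_row i : \sum_j `|drift i j| <= 1 - lambda.
Proof.
apply: le_trans (_ : _ <= \sum_(j < N) (1 - lambda) / N%:R) _.
  by apply: ler_sum => j _; exact: drift_entry.
by rewrite sumr_const card_ord -[_ *+ N]mulr_natr divfK ?gt_eqF.
Qed.

(** Entries are at most [(1 - lambda) / N]. Cauchy-Schwarz against the all-ones vector costs
    [sqrt N] per coordinate, and passing from coordinates to the norm costs another [sqrt N]. *)
Lemma opnorm2_drift : opnorm2 drift <= 1 - lambda.
Proof.
have /andP[l0 l1] := lambda01; have l2 : 0 <= 1 - lambda by lra.
apply: opnorm2_le => // x.
pose o : 'cV[R]_N := \col_i 1; pose y : 'cV[R]_N := \col_i `|x i 0|.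
have xy : norm2 y <= norm2 x by apply: norm2_mono => i; rewrite mxE normr_id.
have o1 : norm2 o <= Num.sqrt N%:R.
  by have := @norm2_le_bound R N o 1 ler01; rewrite mul1r; apply=> i; rewrite mxE normr1.
have c0 : 0 <= (1 - lambda) / N%:R * (Num.sqrt N%:R * norm2 x).
  by rewrite mulr_ge0 ?divr_ge0 ?(ltW Nr0)// mulr_ge0 ?sqrtr_ge0 ?norm2_ge0.
apply: le_trans (norm2_le_bound c0 _) _ => [i|].
  rewrite mxE (le_trans (ler_norm_sum _ _ _))//.
  apply: le_trans (_ : _ <= \sum_j (1 - lambda) / N%:R * `|x j 0|) _.
    by apply: ler_sum => j _; rewrite normrM ler_wpM2r// drift_entry.
  rewrite -mulr_sumr ler_wpM2l ?divr_ge0 ?(ltW Nr0)//.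
  have -> : \sum_j `|x j 0| = dotv o y.
    by rewrite dotvE; apply: eq_bigr => j _; rewrite !mxE mul1r.
  by rewrite (le_trans (dotv_le _ _))// ler_pM ?norm2_ge0.
have e : Num.sqrt N%:R * Num.sqrt N%:R = N%:R :> R by rewrite -expr2 sqr_sqrtr ?(ltW Nr0).
have -> : (1 - lambda) / N%:R * (Num.sqrt N%:R * norm2 x) * Num.sqrt N%:R =
   (1 - lambda) / N%:R * (Num.sqrt N%:R * Num.sqrt N%:R) * norm2 x by ring.
by rewrite e divfK ?gt_eqF.
Qed.

Local Notation eps x y := (innov (ptheta x) y).

Lemma transition_sum (x : S) (f : S -> R) : \sum_(y : S) K x y * f y = berE (ptheta x) f.
Proof. by []. Qed.

Definition mean : 'cV[R]_N := \col_i \sum_(x : S) pi0 x * (x i)%:R.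

Definition zvec (x : 'I_N -> bool) : 'cV[R]_N := bvec x - mean.

Lemma berE_coord (x : S) i : berE (ptheta x) (fun y => (y i)%:R) = ptheta x i.
Proof.
have := berE_innov (ptheta x) i.
have -> : (fun y : S => innov (ptheta x) y i 0) = (fun y : S => (y i)%:R + - ptheta x i).
  by apply/funext => y; rewrite mxE.
by rewrite berED berE_cst => /subr0_eq.
Qed.

Lemma mean_ptheta i : mean i 0 = \sum_(x : S) pi0 x * ptheta x i.
Proof.
rewrite mxE (expectation_state HX); apply: eq_bigr => x _.
by rewrite transition_sum berE_coord.
Qed.

Lemma mean_fixed : mean = intercept + drift *m mean.
Proof.
apply/matrixP => i j; rewrite (ord1 j) mean_ptheta.
under eq_bigr do rewrite ptheta_affine mxE mulrDr.
rewrite big_split/= -mulr_suml sum_pi0 mul1r [RHS]mxE; congr (_ + _).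
under eq_bigr do rewrite mxE mulr_sumr.
rewrite exchange_big [RHS]mxE/=; apply: eq_bigr => k _.
by rewrite [mean k 0]mxE mulr_sumr; apply: eq_bigr => x _; rewrite [bvec x k 0]mxE mulrCA.
Qed.

Lemma innovE (x y : 'I_N -> bool) : eps x y = bvec y - (intercept + drift *m bvec x).
Proof. by apply/matrixP => i j; rewrite (ord1 j) mxE ptheta_affine !mxE. Qed.

Lemma zvec_rec (x y : 'I_N -> bool) : zvec y = drift *m zvec x + eps x y.
Proof.
rewrite innovE /zvec {1}mean_fixed mulmxBr.
rewrite !opprD !addrA; apply/matrixP => i j; rewrite !mxE; ring.
Qed.

Lemma mean01 i : 0 <= mean i 0 <= 1.
Proof.
rewrite mxE; apply/andP; split.
  by apply: sumr_ge0 => x _; rewrite mulr_ge0 ?pi0_ge0.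
rewrite -[leRHS](sum_pi0 X); apply: ler_sum => x _; rewrite ler_piMr ?pi0_ge0//.
by rewrite lern1 leq_b1.
Qed.

Lemma zvec_sqr x i : zvec x i 0 ^+ 2 =
  (1 - 2 * mean i 0) * zvec x i 0 + mean i 0 * (1 - mean i 0).
Proof.
have -> : zvec x i 0 = (x i)%:R - mean i 0 by rewrite /zvec /bvec 2!mxE [(- mean) i 0]mxE.
by case: (x i) => /=; ring.
Qed.

Lemma zvec_le1 x i : `|zvec x i 0| <= 1.
Proof.
have -> : zvec x i 0 = (x i)%:R - mean i 0 by rewrite /zvec /bvec 2!mxE [(- mean) i 0]mxE.
by rewrite ler_norml; have /andP[? ?] := mean01 i; case: (x i) => /=; lra.
Qed.

Definition Sigma0 : 'M[R]_N := \sum_(x : S) pi0 x *: (zvec x *m (zvec x)^T).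

Lemma conj_outer (B : 'M[R]_N) (C : 'M[R]_N) i j :
  (B *m Sigma0 *m C^T) i j = \sum_(x : S) pi0 x * ((B *m zvec x) i 0 * (C *m zvec x) j 0).
Proof.
rewrite /Sigma0 mulmx_sumr mulmx_suml summxE; apply: eq_bigr => x _.
rewrite -scalemxAr -scalemxAl mxE; congr (_ * _).
have -> : B *m (zvec x *m (zvec x)^T) *m C^T = (B *m zvec x) *m (C *m zvec x)^T.
  by rewrite trmx_mul !mulmxA.
by rewrite mxE big_ord1 [((C *m _)^T) _ _]mxE.
Qed.

Lemma Sigma0E i j : Sigma0 i j = \sum_(x : S) pi0 x * (zvec x i 0 * zvec x j 0).
Proof.
have := conj_outer 1%:M 1%:M i j; rewrite trmx1 mulmx1 mul1mx => ->.
by apply: eq_bigr => x _; rewrite mul1mx.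
Qed.

Lemma sum_zvec i : \sum_(x : S) pi0 x * zvec x i 0 = 0.
Proof.
under eq_bigr do rewrite mxE mulrDr [(- mean) i 0]mxE.
rewrite big_split/= -mulr_suml sum_pi0 mul1r mxE.
by under eq_bigr do rewrite mxE; rewrite subrr.
Qed.

Lemma Sigma0_diag i : Sigma0 i i = mean i 0 * (1 - mean i 0).
Proof.
rewrite Sigma0E; under eq_bigr do rewrite -expr2 zvec_sqr mulrDr mulrCA.
by rewrite big_split/= -mulr_sumr sum_zvec mulr0 add0r -mulr_suml sum_pi0 mul1r.
Qed.

(** By stationarity one step of the recursion may be inserted. Terms linear in the innovation
    vanish, and so does the product of two distinct innovations by conditional independence. *)
Lemma Sigma0_offdiag i j : i != j -> Sigma0 i j = (drift *m Sigma0 *m drift^T) i j.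
Proof.
move=> ij; rewrite conj_outer Sigma0E.
rewrite (expectation_state HX (fun x => zvec x i 0 * zvec x j 0)).
apply: eq_bigr => x _; congr (_ * _); rewrite transition_sum.
set a := drift *m zvec x.
have -> : (fun y : S => zvec y i 0 * zvec y j 0) = (fun y : S => a i 0 * a j 0 +
   (a i 0 * eps x y j 0 + (a j 0 * eps x y i 0 + eps x y i 0 * eps x y j 0))).
  apply/funext => y; rewrite (zvec_rec x y) -/a.
  rewrite ![(a + _) _ _]mxE; ring.
rewrite !berED !berEZ !berE_innov (berE_innov2 _ ij).
by rewrite berE_cst !mulr0 !addr0.
Qed.

(** The Yule-Walker relation: given [X_0], the centred state at time 1 has mean [drift *m Z_0]. *)
Lemma Sigma1_drift : Sigma1 X = drift *m Sigma0.
Proof.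
apply/matrixP => i j; rewrite (Sigma1E HX).
have := conj_outer drift 1%:M i j; rewrite trmx1 mulmx1 => ->.
have az (x : S) : (drift *m zvec x) i 0 = ptheta x i - mean i 0.
  rewrite ptheta_affine [in RHS]mean_fixed /zvec mulmxBr.
  have D (B C : 'cV[R]_N) : (B + C) i 0 = B i 0 + C i 0 by rewrite mxE.
  have O (B : 'cV[R]_N) : (- B) i 0 = - B i 0 by rewrite mxE.
  by rewrite !(D, O); ring.
have zx (x : S) : zvec x j 0 = (x j)%:R - mean j 0.
  by rewrite /zvec /bvec 2!mxE [(- mean) j 0]mxE.
under [RHS]eq_bigr do rewrite az mul1mx {1}zx.
have e0 : \sum_(x : S) pi0 x * (\sum_(y : S) K x y * (y i)%:R) * (x j)%:R =
    \sum_(x : S) pi0 x * ptheta x i * (x j)%:R.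
  by apply: eq_bigr => x _; rewrite (transition_sum x (fun y : S => (y i)%:R)) berE_coord.
rewrite e0; have e (x : S) : pi0 x * ((ptheta x i - mean i 0) * ((x j)%:R - mean j 0)) =
   pi0 x * ptheta x i * (x j)%:R - mean j 0 * (pi0 x * ptheta x i)
   - mean i 0 * (pi0 x * zvec x j 0) by rewrite zx; ring.
under [RHS]eq_bigr do rewrite e.
rewrite !sumrB -!mulr_sumr sum_zvec mulr0 subr0 -mean_ptheta mulrC; congr (_ - _ * _); rewrite mxE//.
Qed.

End Model.

(** * Tail bound by a union over noise terms and grid points *)

Section TailBound.
Context d (Omega : measurableType d) (R : realType) (P : probability Omega R) (N : nat).
Variables (X : 'I_N -> int -> {RV P >-> bool}) (lambda mu : R) (Pp Pm : {set 'I_N}).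
Variable theta : 'M[bool]_N.
Hypothesis N0 : (0 < N)%N.
Hypothesis lambda01 : 0 < lambda < 1.
Hypothesis mu_le : 0 < mu <= lambda.
Hypothesis PpmU : (Pp :|: Pm)%SET = finset.setT.
Hypothesis PpmI : (Pp :&: Pm)%SET = finset.set0.
Hypothesis HX : stationary_chain X lambda mu Pp Pm theta.
Local Notation S := {ffun 'I_N -> bool}.
Local Notation pr := (pr P).
Local Notation K := (transition lambda mu Pp Pm theta).
Local Notation ptheta := (ptheta lambda mu Pp Pm theta).
Local Notation eps x y := (innov (ptheta x) y).
Local Notation Z := (zvec X).
Local Notation state := (state X).

Let p01 x i : 0 <= ptheta x i <= 1.
Proof. exact: ptheta01. Qed.

(* Log-increments of the supermartingales controlling the mean of [eps] ([None]), the
   mean of [eps_{t+1} Z_t^T] ([Some true]), and the off-diagonal part of the mean of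
   [eps eps^T] ([Some false]). *)
Definition noise (o : option bool) (s : R) (u v : 'cV[R]_N) (x y : S) : R :=
  match o with
  | None => s * dotv u (eps x y) - 2 * s ^+ 2
  | Some true => s * (dotv u (eps x y) * dotv v (Z x)) - 2 * (s * dotv v (Z x)) ^+ 2
  | Some false => s * quadinnov (ptheta x) u v y - Cquad R * s ^+ 2
  end.

(** In each case the subtracted term compensates the log-moment bound. For [Some true] the factor
    [s * (v . Z)] is fixed given [x], so the linear bound applies with it as coefficient. *)
Lemma noise_mgf o s u v (x : S) : norm2 u <= 1 -> norm2 v <= 1 -> 0 <= s <= 24^-1 ->
  \sum_(y : S) K x y * expR (noise o s u v x y) <= 1.
Proof.
move=> u1 v1 s01.
have lin (c : R) : berE (ptheta x) (fun y => expR (c * dotv u (eps x y) - 2 * c ^+ 2)) <= 1.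
  have -> : (fun y : S => expR (c * dotv u (eps x y) - 2 * c ^+ 2)) =
      (fun y : S => expR (- (2 * c ^+ 2)) * expR (dotv (c *: u) (eps x y))).
    by apply/funext => y; rewrite dotvZl addrC expRD.
  rewrite berEZ -[leRHS](mulVf (_ : expR (2 * c ^+ 2) != 0)) ?gt_eqF ?expR_gt0// -expRN.
  rewrite ler_wpM2l ?expR_ge0//; apply: le_trans (berE_expR_le (p01 x) _) _.
  rewrite ler_expR ler_wpM2l// norm2Z exprMn real_normK ?num_real// ler_piMr ?sqr_ge0//.
  by rewrite expr_le1// norm2_ge0.
rewrite (transition_sum lambda mu Pp Pm theta x (fun y : S => expR (noise o s u v x y))).
case: o => [[|]|] /=; last exact: lin.
  apply: le_trans (lin (s * dotv v (Z x))); rewrite le_eqVlt; apply/orP; left.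
  by apply/eqP; apply: eq_bigr => y _; rewrite -[_ * dotv u _]mulrA [dotv v _ * dotv u _]mulrC.
have -> : (fun y : S => expR (s * quadinnov (ptheta x) u v y - Cquad R * s ^+ 2)) =
    (fun y : S => expR (- (Cquad R * s ^+ 2)) * expR (s * quadinnov (ptheta x) u v y)).
  by apply/funext => y; rewrite addrC expRD.
rewrite berEZ -[leRHS](mulVf (_ : expR (Cquad R * s ^+ 2) != 0)) ?gt_eqF ?expR_gt0// -expRN.
by rewrite ler_wpM2l ?expR_ge0// berE_expR_quadinnov_le.
Qed.

(** The grid bound [(1 + Cquad R) * s] for the off-diagonal noise, doubled by [opnorm2_le_net]. *)
Let g : R := 2 * (1 + Cquad R).

Let Cquad0 : 0 <= Cquad R.
Proof. by rewrite /Cquad mulr_ge0 ?ler0n ?expR_ge0. Qed.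

Lemma dotv_offdiag (e u v : 'cV[R]_N) :
  dotv u ((\matrix_(i, j) (if i == j then 0 else (e *m e^T) i j)) *m v) =
  dotv u e * dotv v e - \sum_i u i 0 * v i 0 * e i 0 ^+ 2.
Proof.
have ee i j : (e *m e^T) i j = e i 0 * e j 0 by rewrite mxE big_ord1 [(e^T) _ _]mxE.
rewrite !dotvE [in RHS]mulr_suml -sumrB; apply: eq_bigr => i _.
rewrite mxE [in LHS](bigD1 i)//= [X in _ - X](_ : _ = u i 0 * e i 0 * (v i 0 * e i 0)); last by ring.
rewrite [\sum_j v j 0 * _](bigD1 i)//= [in RHS]mulrDr [RHS]addrC addKr.
rewrite mxE eqxx mul0r add0r !mulr_sumr; apply: eq_bigr => j /negbTE ji.
by rewrite mxE eq_sym ji ee; ring.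
Qed.

Lemma tavg_dotv (T : nat) (F : nat -> 'M[R]_N) u v :
  dotv u (tavg T F *m v) = T%:R^-1 * \sum_(1 <= t < T.+1) dotv u (F t *m v).
Proof.
rewrite -tavg_mulr /tavg dotvZr dotv_sumr; congr (_ * _).
Qed.

Lemma Sigma1hat_bound (T : nat) (s : R) (w : Omega) : (0 < T)%N ->
  0 < s -> s <= lambda / 16 -> (6 + g) * s <= 1 -> N%:R / T%:R <= s ^+ 2 ->
  (forall o (k l : net N), norm2 (netpt R k) <= 1 -> norm2 (netpt R l) <= 1 ->
    \sum_(1 <= t < T.+1) noise o s (netpt R k) (netpt R l) (state t w) (state t.+1 w) < s ^+ 2 * T%:R) ->
  opnorm2 (Sigma1hat X T w - Sigma1 X) <= (266 + 4 * g) / lambda ^+ 3 * s.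
Proof.
move=> T0 sp s1 s2 NT H.
have Tp : 0 < T%:R :> R by rewrite ltr0n.
have s0 := ltW sp.
pose z (t : nat) := Z (state t w); pose e (t : nat) := eps (state t w) (state t.+1 w).
have oE t : obs X t w = z t + mean X.
  by rewrite /z /zvec subrK; apply/matrixP => i j; rewrite !mxE ffunE.
have mE : mhat X T w = tavg T z + mean X.
  have -> : mhat X T w = tavg T (fun t => z t + mean X).
    by rewrite /mhat /tavg; congr (_ *: _); apply: eq_bigr => t _.
  by rewrite tavgD tavg_cst.
have -> : Sigma1hat X T w = tavg T (fun t => (z t.+1 - tavg T z) *m (z t - tavg T z)^T).
  rewrite /Sigma1hat /tavg; congr (_ *: _); apply: eq_bigr => t _.
  have canc (a b c : 'cV[R]_N) : a + c - (b + c) = a - b by rewrite opprD addrACA subrr addr0.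
  by rewrite !oE mE !canc.
rewrite (Sigma1_drift PpmU PpmI HX).
have split_lt (b c : R) : b < c * s * T%:R -> T%:R^-1 * b <= c * s.
  by move=> h; rewrite mulrC ler_pdivrMr// ltW.
have LRB := @linear_recursion_bound R N T lambda g s (drift lambda Pp theta) (Sigma0 X) (mean X) z e.
apply: LRB => //.
- exact: opnorm2_drift.
- exact: drift_row.
- by move=> t; apply: zvec_rec.
- by move=> t i; apply: zvec_le1.
- by move=> t i; apply: innov_norm_le1.
- exact: mean01.
- by move=> t i; apply: zvec_sqr.
- exact: Sigma0_diag.
- by move=> i j ij; apply: (Sigma0_offdiag PpmU PpmI HX).
- by rewrite mulr_ge0// addr_ge0.
- set S0 := tavg T (fun t => z t *m (z t)^T).
  apply: opnorm2_le_net => //; first by rewrite addr_ge0// mulr_ge0 ?opnorm2_ge0// mulr_ge0.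
  move=> k l k1 l1; set u := netpt R k; set v := netpt R l.
  apply: (@le_trans _ _ (2 * s * dotv v (S0 *m v) + s)); last first.
    rewrite lerD2r ler_wpM2l ?mulr_ge0//.
    rewrite (le_trans (ler_norm _))// (le_trans (opnorm2_dotv _ _ _))//.
    by rewrite ler_piMr ?opnorm2_ge0// mulr_ile1 ?norm2_ge0.
  (* Divided by [s T], this reads [u . M v < 2 s (v . S0 v) + s]: the self-normalising term becomes
     the quadratic form of [S0]. *)
  have := H (Some true) k l k1 l1; rewrite /noise /= -/u -/v.
  rewrite /S0 !tavg_dotv.
  have outer (a b : 'cV[R]_N) : dotv u (a *m b^T *m v) = dotv u a * dotv v b.
    rewrite /dotv -!mulmxA [b^T *m v]mx11_scalar mul_mx_scalar -scalemxAr mxE mulrC.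
    by congr (_ * _); exact: dotvC.
  have outer2 (a b : 'cV[R]_N) : dotv v (a *m b^T *m v) = dotv v a * dotv v b.
    rewrite /dotv -!mulmxA [b^T *m v]mx11_scalar mul_mx_scalar -scalemxAr mxE mulrC.
    by congr (_ * _); exact: dotvC.
  under [X in _ -> _ * X <= _]eq_bigr do rewrite outer.
  under [X in _ -> _ <= _ * (_ * X) + _]eq_bigr do rewrite outer2 -expr2.
  under eq_bigr do rewrite exprMn.
  rewrite sumrB -!mulr_sumr -/u -/v.
  set a := \sum_(1 <= i < T.+1) _; set b := \sum_(1 <= i < T.+1) _ => h.
  rewrite mulrC ler_pdivrMr//.
  have -> : (2 * s * (T%:R^-1 * b) + s) * T%:R = 2 * (s * b) + s * T%:R by field; rewrite gt_eqF.
  rewrite -(ler_pM2l sp) mulrDr.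
  have -> : s * (2 * (s * b)) + s * (s * T%:R) = 2 * s ^+ 2 * b + s ^+ 2 * T%:R by ring.
  by move: h; lra.
- have gs : g * s = 2 * ((1 + Cquad R) * s) by rewrite /g; ring.
  rewrite gs; apply: opnorm2_le_net => //; first by rewrite mulr_ge0// addr_ge0.
  move=> k l k1 l1; set u := netpt R k; set v := netpt R l.
  set D := fun t => \matrix_(i, j) (if i == j then 0 else (e t *m (e t)^T) i j) : 'M[R]_N.
  rewrite (_ : \matrix_(i, j) _ = tavg T D); last first.
    apply/matrixP => i j; rewrite [LHS]mxE [RHS]tavgE /D.
    under [in RHS]eq_bigr do rewrite mxE.
    by case: ifP => _; [rewrite big1 ?mulr0|rewrite tavgE].
  rewrite tavg_dotv; apply: split_lt.
  have := H (Some false) k l k1 l1; rewrite /noise /= -/u -/v sumrB -mulr_sumr.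
  rewrite sumr_const_nat subn1/= -[(Cquad R * s ^+ 2) *+ T]mulr_natr.
  under [X in _ -> X < _]eq_bigr do rewrite /D dotv_offdiag.
  rewrite -[\sum_(1 <= t < T.+1) (dotv u (e t) * _ - _)]/(
    \sum_(1 <= t < T.+1) quadinnov (ptheta (state t w)) u v (state t.+1 w)).
  move=> h; rewrite -(ltr_pM2l sp); move: h; lra.
(* The threshold contributes 1 and the compensator 2 to the 3; the grid doubles it. *)
- have -> : 6 * s = 2 * (3 * s) by ring.
  apply: norm2_le_net => //; first by rewrite mulr_ge0.
  move=> k k1; set u := netpt R k.
  rewrite /tavg dotvZr dotv_sumr; apply: split_lt.
  have := H None k k k1 k1; rewrite /noise /= -/u sumrB -mulr_sumr.
  rewrite sumr_const_nat subn1/= -[(2 * s ^+ 2) *+ T]mulr_natr.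
  by move=> h; rewrite -(ltr_pM2l sp); move: h; rewrite /e; lra.
Qed.

Lemma Sigma1hat_tail (T : nat) (s c : R) : (0 < T)%N ->
  0 < s -> s <= lambda / 16 -> (6 + g) * s <= 1 -> N%:R / T%:R <= s ^+ 2 ->
  (266 + 4 * g) / lambda ^+ 3 * s < c ->
  (P [set w | (c <= opnorm2 (Sigma1hat X T w - Sigma1 X))%R] <=
   (3 * (((2 * (4 * N).+1) ^ N) ^ 2)%N%:R * expR (- (s ^+ 2 * T%:R)))%:E)%E.
Proof.
move=> T0 sp s1 s2 NT sc.
set E := [set w | _].
have mE : measurable E.
  apply: (@measurable_of_walk _ _ _ _ _ X T.+1) => w w' ww.
  suff e : Sigma1hat X T w = Sigma1hat X T w' by rewrite /E /= e.
  have st (n t : nat) : walk X n w = walk X n w' -> (0 < t <= n)%N -> state t w = state t w'.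
    elim: n => [|n IH] /=; first by case: t.
    move=> [h1 h2] /andP[t0]; rewrite leq_eqVlt => /orP[/eqP -> //|tn].
    by apply: IH => //; rewrite t0.
  have ob t : (0 < t <= T.+1)%N -> obs X t w = obs X t w'.
    move=> ht; apply/matrixP => i j; rewrite !mxE.
    by have /ffunP/(_ i) := st _ _ ww ht; rewrite !ffunE => ->.
  have mh : mhat X T w = mhat X T w'.
    rewrite /mhat; congr (_ *: _); rewrite !big_nat; apply: eq_bigr => t /andP[t0 tT].
    by rewrite ob// t0 ltnW.
  rewrite /Sigma1hat mh; congr (_ *: _); rewrite !big_nat; apply: eq_bigr => t /andP[t0 tT].
  by rewrite !ob// ?t0 ?(ltnW tT).
rewrite -prE// lee_fin.
pose idx : finType := (option bool * net N * net N)%type.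
(* Grid points outside the unit ball get the increment 0, whose exponential has mean 1, so the
   Chernoff bound holds for every index. *)
pose G (i : idx) (x y : S) : R :=
  if (norm2 (netpt R i.1.2) <= 1) && (norm2 (netpt R i.2) <= 1) then
    noise i.1.1 s (netpt R i.1.2) (netpt R i.2) x y else 0.
pose F (i : idx) := [set w | s ^+ 2 * T%:R <= \sum_(1 <= t < T.+1) G i (state t w) (state t.+1 w)].
(* Since [g >= 18], the assumption [(6 + g) s <= 1] already forces [s <= 1/24]. *)
have s24 : 0 <= s <= 24^-1.
  rewrite ltW//=.
  have : 4608 <= Cquad R by rewrite /Cquad ler_peMr ?ler0n// -[leLHS](expR0 R) ler_expR ler0n.
  have h1 : 18 <= (4608 : R) by rewrite ler_nat.
  move/(le_trans h1) => h2; have h3 : 18 * s <= g * s by rewrite ler_wpM2r ?ltW// /g; lra.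
  by move: s2; lra.
have mF i : measurable (F i).
  apply: (@measurable_of_walk _ _ _ _ _ X T.+1) => w w' ww.
  by rewrite /F /= -!addf_walk ww.
apply: le_trans (pr_union_le P mE mF _) _.
  move=> w Ew; apply: contrapT => nF.
  have : opnorm2 (Sigma1hat X T w - Sigma1 X) < c.
    apply: le_lt_trans sc; apply: Sigma1hat_bound => // o k l k1 l1.
    rewrite ltNge; apply/negP => h; apply: nF; exists (o, k, l).
    by rewrite /F /= /G/= k1 l1.
  by rewrite ltNge => /negP; apply; exact: Ew.
apply: le_trans (ler_sum _ (fun i _ => chain_chernoff HX (g := G i) _ T (s ^+ 2 * T%:R))) _.
  move=> i _ x; rewrite /G.
  case: (boolP ((norm2 (netpt R i.1.2) <= 1) && (norm2 (netpt R i.2) <= 1))) => [/andP[h1 h2]|_].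
    exact: noise_mgf.
  rewrite (transition_sum lambda mu Pp Pm theta x (fun=> expR 0)) expR0 berE1//.
rewrite sumr_const -[_ *+ _]mulr_natl ler_wpM2r ?expR_ge0//.
by rewrite !card_prod card_option card_bool !card_net -mulnA mulnn natrM.
Qed.

End TailBound.

(** * Numerical estimates and choice of constants *)

Lemma expR_le_inv (R : realType) (x : R) : x < 1 -> expR x <= (1 - x)^-1.
Proof.
move=> x1; rewrite -[leLHS]invrK -expRN lef_pV2 ?posrE ?expR_gt0 ?subr_gt0//.
exact: expR_ge1Dx.
Qed.

Lemma ln_ge (R : realType) (x y : R) : 0 < y -> expR x <= y -> x <= ln y.
Proof. by move=> y0 h; rewrite -ler_expR lnK ?posrE. Qed.

(** From [expR (1/5) <= 5/4], whose cube [125/64] is below 2. *)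
Lemma ln2_ge (R : realType) : 3 / 5 <= ln 2 :> R.
Proof.
apply: ln_ge => //; rewrite expRM_natl.
have : expR 5^-1 <= 5 / 4 :> R.
  by apply: le_trans (expR_le_inv _) _; [lra | rewrite le_eqVlt; apply/orP; left; apply/eqP; field].
move=> h; apply: le_trans (_ : _ <= (5 / 4) ^+ 3) _; last by rewrite !exprS; lra.
by rewrite lerXn2r ?nnegrE ?expR_ge0//; lra.
Qed.

(** The exponent [14 N] splits as [10 N] for pairs of grid points, [2 N] for the three noise terms,
    and [2 N] for the factor [N T] that leaves a decaying probability. *)
Lemma net_count_le (N T : nat) : (2 <= N)%N -> (N <= T)%N ->
  (3 * ((2 * (4 * N).+1) ^ N) ^ 2 * (N * T) <= T ^ (14 * N))%N.
Proof.
move=> N2 NT; have T2 : (2 <= T)%N by apply: leq_trans NT.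
have T0 : (0 < T)%N by apply: leq_trans T2.
have h1 : (2 * (4 * N).+1 <= T ^ 5)%N.
  apply: (@leq_trans (16 * T)); first by lia.
  by rewrite (expnSr T 4) leq_mul2r; apply/orP; right; apply: (@leq_trans (2 ^ 4)) => //; rewrite leq_exp2r.
have h2 : (((2 * (4 * N).+1) ^ N) ^ 2 <= T ^ (10 * N))%N.
  rewrite -expnM; apply: (@leq_trans ((T ^ 5) ^ (N * 2))).
    by rewrite leq_exp2r//; lia.
  by rewrite -expnM leq_exp2l//; lia.
have h3 : (3 <= T ^ (2 * N))%N.
  apply: (@leq_trans (2 ^ 4)) => //; apply: (@leq_trans (T ^ 4)); first by rewrite leq_exp2r.
  by rewrite leq_exp2l//; lia.
have h4 : (N * T <= T ^ (2 * N))%N.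
  apply: (@leq_trans (T ^ 2)); first by rewrite expnS expn1 leq_mul2r NT orbT.
  by rewrite leq_exp2l//; lia.
have -> : (14 * N = 2 * N + 10 * N + 2 * N)%N by lia.
by rewrite [X in (_ <= X)%N]expnD [(T ^ (_ + _))%N]expnD; exact: (leq_mul (leq_mul h3 h2) h4).
Qed.

Theorem theoremD1 (R : realType) (lambda : R) (hlambda : 0 < lambda < 1) :
  exists K1 K2 K3 : R, [/\ 0 < K1, 0 < K2, 0 < K3 &
    forall (mu : R) (N T : nat) (Pp Pm : {set 'I_N}) (theta : 'M[bool]_N)
      (d : measure_display) (Omega : measurableType d)
      (P : probability Omega R) (X : 'I_N -> int -> {RV P >-> bool}),
      0 < mu <= lambda ->
      (Pp :|: Pm)%SET = finset.setT ->
      (Pp :&: Pm)%SET = finset.set0 ->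
      stationary_chain X lambda mu Pp Pm theta ->
      (2 <= N)%N ->
      Num.max (K3 * N%:R * ln T%:R * ln (N%:R * ln T%:R)) 2 <= T%:R ->
      (P [set w | (K1 * Num.sqrt (N%:R * ln T%:R * ln (N%:R * ln T%:R) / T%:R)
                   <= opnorm2 (Sigma1hat X T w - Sigma1 X))%R]
       <= (K2 * (Num.sqrt (N%:R / T%:R) + (N%:R * ln T%:R)^-1))%:E)%E].
Proof.
have /andP[l0 l1] := hlambda.
pose g : R := 2 * (1 + Cquad R).
have C0 : 0 <= Cquad R by rewrite /Cquad mulr_ge0 ?ler0n ?expR_ge0.
have g0 : 0 <= g by rewrite /g; move: C0; lra.
(* Small enough that [s <= s0] gives both [s <= lambda / 16] and [(6 + g) s <= 1]. *)
pose s0 : R := lambda / 16 / (6 + g).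
have g6 : 0 < 6 + g by lra.
have s00 : 0 < s0 by rewrite !divr_gt0.
pose Cf : R := (266 + 4 * g) / lambda ^+ 3.
have Cf0 : 0 < Cf by apply: divr_gt0 (exprn_gt0 3 l0); move: g0; lra.
(* With [W >= 1/6], the part [84 = 14 * 6] yields [s <= s0]; with also [L >= 3/5], the part 10
   yields [N <= T]. *)
pose K3 : R := 84 / s0 ^+ 2 + 10.
have K30 : 84 / s0 ^+ 2 <= K3 by rewrite /K3; lra.
have K310 : 10 <= K3 by rewrite /K3 lerDr divr_ge0// sqr_ge0.
exists (10 * Cf), 1, K3; split => //; [by rewrite mulr_gt0 | by move: K310; lra |].
move=> mu N T Pp Pm theta d Omega P X mul PpmU PpmI HX N2.
rewrite ge_max => /andP[TK T2].
have Tp : 0 < T%:R :> R by lra.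
have Np : 2 <= N%:R :> R by rewrite ler_nat.
set L := ln T%:R in TK *; set W := ln (N%:R * L) in TK *.
have L35 : 3 / 5 <= L.
  by apply: le_trans (ln2_ge R) _; rewrite ler_ln ?posrE.
have NL : 6 / 5 <= N%:R * L.
  by apply: le_trans (_ : _ <= 2 * (3 / 5)) _; [lra | rewrite ler_pM//; lra].
have W16 : 6^-1 <= W.
  apply: ln_ge; first lra.
  apply: le_trans (expR_le_inv _) _; first lra.
  by apply: le_trans NL; rewrite le_eqVlt; apply/orP; left; apply/eqP; field.
have NL0 : 0 < N%:R * L by lra.
have TK' : K3 * (N%:R * L) * W <= T%:R by rewrite mulrA.
have NT : N%:R <= T%:R :> R.
  apply: le_trans TK'; apply: le_trans (_ : _ <= 10 * (N%:R * (3 / 5)) * 6^-1) _; first lra.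
  by rewrite !ler_pM ?mulr_ge0//; lra.
have T0 : (0 < T)%N by rewrite -(ltr0n R).
(* Chosen so that [expR (- s^2 T) = T ^ (- 14 N)], matching the grid count. *)
pose s := Num.sqrt (14 * (N%:R * L) / T%:R).
have y0 : 0 < 14 * (N%:R * L) / T%:R by rewrite divr_gt0// mulr_gt0.
have sp : 0 < s by rewrite sqrtr_gt0.
have ssq : s ^+ 2 = 14 * (N%:R * L) / T%:R by rewrite sqr_sqrtr// ltW.
have sT : s ^+ 2 * T%:R = 14 * (N%:R * L) by rewrite ssq divfK ?gt_eqF.
have ss0 : s <= s0.
  rewrite -(ler_pXn2r (n := 2))// ?nnegrE ?(ltW sp) ?(ltW s00)// ssq ler_pdivrMr//.
  have : 84 / s0 ^+ 2 * (N%:R * L) * 6^-1 <= T%:R.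
    apply: le_trans TK'; rewrite !ler_pM ?mulr_ge0 ?invr_ge0 ?(ltW NL0) ?sqr_ge0//; lra.
  move/(ler_wpM2l (sqr_ge0 s0)).
  have -> : s0 ^+ 2 * (84 / s0 ^+ 2 * (N%:R * L) * 6^-1) = 14 * (N%:R * L).
    by field; rewrite gt_eqF.
  by [].
have g1 : 1 <= 6 + g by lra.
have s1 : s <= lambda / 16.
  apply: le_trans ss0 _; rewrite /s0 ler_pdivrMr// ler_peMr//; lra.
have s2 : (6 + g) * s <= 1.
  by rewrite mulrC -ler_pdivlMr//; apply: le_trans ss0 _; rewrite /s0 ler_wpM2r ?invr_ge0 ?(ltW g6)//; lra.
have NTs : N%:R / T%:R <= s ^+ 2.
  rewrite ssq ler_wpM2r ?invr_ge0 ?(ltW Tp)//.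
  have : N%:R * (3 / 5) <= N%:R * L by rewrite ler_wpM2l//.
  lra.
(* After squaring, this is [14 < 100 W], true because [W >= 1/6]. *)
have sc : Cf * s < 10 * Cf * Num.sqrt (N%:R * L * W / T%:R).
  rewrite (mulrC 10 Cf) -[ltRHS]mulrA ltr_pM2l//.
  rewrite -(ltr_pXn2r (n := 2))// ?nnegrE ?mulr_ge0 ?sqrtr_ge0 ?(ltW sp)//.
  rewrite exprMn ssq sqr_sqrtr; last by rewrite divr_ge0 ?mulr_ge0 ?(ltW Tp)//; lra.
  rewrite ltr_pdivrMr// -[ltRHS]mulrA divfK ?gt_eqF//.
  have := ler_wpM2l (ltW NL0) W16; rewrite expr2; move: (N%:R * L) NL0 => q; lra.
have := Sigma1hat_tail (ltnW N2) hlambda mul PpmU PpmI HX T0 sp s1 s2 NTs sc.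
move/le_trans; apply; rewrite lee_fin mul1r.
apply: le_trans (_ : _ <= (N%:R * L)^-1) _; last by rewrite lerDr sqrtr_ge0.
rewrite sT expRN.
have -> : expR (14 * (N%:R * L)) = T%:R ^+ (14 * N).
  rewrite mulrA -natrM expRM_natl lnK// posrE//.
rewrite -[leRHS]div1r ler_pdivlMr// mulrAC ler_pdivrMr ?exprn_gt0// mul1r.
have NTn : (N <= T)%N by rewrite -(ler_nat R).
have := net_count_le N2 NTn; rewrite -(ler_nat R) natrX; apply: le_trans.
(* The spare factor [N T] of the count dominates [N ln T]. *)
rewrite !natrM ler_wpM2l ?mulr_ge0// ler_wpM2l// ltW// ln_sublinear//.
Qed.
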